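(* Let $\lambda_0,\lambda_1,\nu_1,\nu_2,\gamma,\tau>0$ and suppose the stability condition $$\lambda_{0}\left(\frac{1}{\nu_{1}}+\frac{1}{\nu_{2}}\right)\frac{\tau}{\tau+\gamma}+\lambda_{1}\left(\frac{1}{\nu_{1}}+\frac{1}{\nu_{2}}\right)\frac{\gamma}{\tau+\gamma}<\frac{\tau}{\tau+\gamma}$$ holds. Let $\Pi_0(x,y),\Pi_1(x,y)$ (depending on the parameter $p$) be the stationary generating functions of the tandem queue with coupled processors and global breakdowns described in the context, and let $V_m^{(j)}(x,y)$, $m\ge 0$, $j=0,1$, be the coefficients of their power series expansions in $p$ at $p=0$, i.e. $\Pi_j(x,y)=\sum_{m=0}^{\infty}V_m^{(j)}(x,y)p^m$. Then, as identities of functions of $(x,y)$ with $|x|\le 1$, $|y|\le 1$ (wherever the denominators do not vanish), $$V_{0}^{(0)}(x,y)=\frac{D(x)\nu_{1}\nu_{2}\,(\tilde{Y}(x)-y)\,(\tilde{Y}(x)(y-1)+x-y)}{G(x,y)\,[\nu_{2}x(\tilde{Y}(x)-1)-\nu_{1}\tilde{Y}(x)(x-\tilde{Y}(x))]}\,V_0^{(0)}(0,0),$$ $$V_{m}^{(0)}(x,y)=\frac{G_{10}(x,y)}{G(x,y)}\,Q_{m-1}(x,y),\qquad m>0,$$ $$V_{m}^{(1)}(x,y)=\frac{\gamma}{D(x)}\,V_{m}^{(0)}(x,y),\qquad m\ge 0,$$ where $$\tilde{Y}(x)=\frac{\nu_{2}D(x)}{D(x)(\nu_{2}+\lambda_{0}(1-x))+\lambda_{1}\gamma(1-x)},$$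 $$Q_{m}(x,y)=V_{m}^{(0)}(x,y)-V_{m}^{(0)}(x,\tilde{Y}(x))-V_{m}^{(0)}(0,y)+V_{m}^{(0)}(0,\tilde{Y}(x)),\qquad m\ge 0,$$ and $D$, $G$, $G_{10}$ are $$D(x)=\lambda_1(1-x)+\tau,$$ $$G(x,y)=D(x)[\lambda_{0}y(1-x)+\nu_{2}(y-1)]+\lambda_{1}\gamma y(1-x),$$ $$G_{10}(x,y)=D(x)[\nu_{2}(y-1)-\nu_{1}y(1-yx^{-1})].$$
   Context: Model. Fix $p\in[0,1]$ and consider the continuous-time Markov chain $X(t)=(C(t),Q_1(t),Q_2(t))$ on $\{0,1\}\times\mathbb{Z}_{\ge 0}\times\mathbb{Z}_{\ge 0}$; $C(t)=0$ means the network is in operating mode, $C(t)=1$ that it is in setup mode (after a breakdown), and $Q_j(t)$ is the number of jobs at station $j$. The transition rates are: (i) arrivals: from $(i,n,k)$ to $(i,n+1,k)$ at rate $\lambda_i$, $i=0,1$; (ii) breakdowns: from $(0,n,k)$ to $(1,n,k)$ at rate $\gamma$; repairs: from $(1,n,k)$ to $(0,n,k)$ at rate $\tau$; (iii) services, only in operating mode. If $n\ge1$ and $k\ge 1$: from $(0,n,k)$ to $(0,n-1,k+1)$ at rate $p\nu_1$ and to $(0,n,k-1)$ at rate $(1-p)\nu_2$. If $n\ge 1$ and $k=0$: from $(0,n,0)$ to $(0,n-1,1)$ at rate $\nu_1$. If $n=0$ and $k\ge1$: from $(0,0,k)$ to $(0,0,k-1)$ at rate $\nu_2$. Let $\pi_i(n,k)$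 denote the stationary probability of the state $(i,n,k)$, and $$\Pi_i(x,y)=\sum_{n=0}^\infty\sum_{k=0}^\infty \pi_i(n,k)x^ny^k,\quad i=0,1,\ |x|\le1,\ |y|\le 1.$$ These depend on $p$ and are regarded as functions of $p$ that are analytic in a neighbourhood of $p=0$; $V_m^{(j)}(x,y)$ is the coefficient of $p^m$ in the expansion of $\Pi_j(x,y)$ at $p=0$. *)

(* Defs.v *)
From Stdlib Require Export Reals.
From Coquelicot Require Export Coquelicot.

Open Scope R_scope.
Open Scope C_scope.

(* [Operating] is C(t) = 0 and [Setup] is C(t) = 1; a state (i, n, k) lists the
   mode, the queue length at station 1 and the queue length at station 2. *)
Inductive mode : Set := Operating | Setup.

Definition state : Set := (mode * nat * nat)%type.

Definition state_eq_dec (s t : state) : {s = t} + {s <> t}.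
Proof. repeat decide equality. Defined.

Record params := Params {
  lam0 : R;  (* arrival rate in operating mode *)
  lam1 : R;  (* arrival rate in setup mode *)
  nu1 : R;
  nu2 : R;
  gam : R;   (* breakdown rate *)
  tau : R    (* repair rate *)
}.

Definition jump (target : state) (r : R) (t : state) : R :=
  if state_eq_dec t target then r else 0%R.

(* [rate a p s t] is the transition rate from s to t; every listed target
   differs from s, so this is the off-diagonal part of the generator. *)
Definition rate (a : params) (p : R) (s t : state) : R :=
  (match s with
   | (Operating, n, k) =>
       jump (Operating, S n, k) (lam0 a) t
       + jump (Setup, n, k) (gam a) t
       + match n, k with
         | S n', S k' =>
             jump (Operating, n', S k) (p * nu1 a) t
             + jump (Operating, n, k') ((1 - p) * nu2 a) t
         | S n', O => jump (Operating, n', 1%nat) (nu1 a) t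
         | O, S k' => jump (Operating, O, k') (nu2 a) t
         | O, O => 0
         end
   | (Setup, n, k) =>
       jump (Setup, S n, k) (lam1 a) t
       + jump (Operating, n, k) (tau a) t
   end)%R.

(* Sum over all states, as an iterated series. It is only used for nonnegative f,
   for which the order of summation is immaterial. *)
Definition is_state_sum (f : state -> R) (l : R) : Prop :=
  exists row : mode -> nat -> R,
    (forall i n, is_series (fun k => f (i, n, k)) (row i n)) /\
    is_series (fun n => (row Operating n + row Setup n)%R) l.

(* Stationary distribution of the chain with off-diagonal rates q. The balance
   equation at t reads  sum_s mu(s) q(s,t) = mu(t) * sum_s q(t,s);  the rates
   of the chain above are bounded, so this is invariance under its semigroup. *)
Record is_stationary (q : state -> state -> R) (mu : state -> R) : Prop := {
  stat_nonneg : forall s, (0 <= mu s)%R;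
  stat_mass : is_state_sum mu 1%R;
  stat_balance : forall t, exists out : R,
    is_state_sum (q t) out /\
    is_state_sum (fun s => (mu s * q s t)%R) (mu t * out)%R
}.

(* Sum of a convergent complex series, by components (compare [Series]). *)
Definition CSeries (u : nat -> C) : C :=
  (Series (fun n => Re (u n)), Series (fun n => Im (u n))).

(* Generating function Pi_i(x,y); for a probability mu and |x|, |y| <= 1 both
   series converge absolutely. *)
Definition gen_fun (mu : state -> R) (i : mode) (x y : C) : C :=
  CSeries (fun n => CSeries (fun k => RtoC (mu (i, n, k)) * x ^ n * y ^ k)).

(* f, a function of the model parameter p in [0,1], is near p = 0 the sum of the
   power series with coefficients c. These are determined by f, since 0 is an
   accumulation point of [0,1]. *)
Definition expands_at_0 (f : R -> C) (c : nat -> C) : Prop :=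
  exists eps : R, (0 < eps)%R /\
    forall p : R, (0 <= p <= 1)%R -> (p < eps)%R ->
      is_pseries (K := C_AbsRing) (V := C_NormedModule) c (RtoC p) (f p).

(* For |x| <= 1, neither [D a x] nor the denominator of [Ytilde a x] vanishes and
   |Ytilde a x| <= 1. *)
Definition D (a : params) (x : C) : C := lam1 a * (1 - x) + tau a.

Definition G (a : params) (x y : C) : C :=
  D a x * (lam0 a * y * (1 - x) + nu2 a * (y - 1)) + lam1 a * gam a * y * (1 - x).

Definition G10 (a : params) (x y : C) : C :=
  D a x * (nu2 a * (y - 1) - nu1 a * y * (1 - y * / x)).

Definition Ytilde (a : params) (x : C) : C :=
  nu2 a * D a x
  / (D a x * (nu2 a + lam0 a * (1 - x)) + lam1 a * gam a * (1 - x)).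

(* Q_m, for the coefficients V m i of the p-expansions of Pi_i. *)
Definition Q (a : params) (V : nat -> mode -> C -> C -> C) (m : nat) (x y : C) : C :=
  V m Operating x y - V m Operating x (Ytilde a x)
  - V m Operating 0 y + V m Operating 0 (Ytilde a x).

(* Main.v *)
Require Import Defs.
From Stdlib Require Import Lra Lia.

(** Write [P_p] for the generating function of the operating states at coupling
    parameter [p].  Summing the balance equations row by row gives
    [D * P_setup = gam * P_p] and the functional equation
      [x G(x,y) P_p(x,y) = D(x) (k(x,y) L_p(x,y) + nu1 y (x - y) P_p(0,0))],
    where [k(x,y) = nu2 x (y - 1) - nu1 y (x - y)] and the unknown boundary
    terms are collected in the load of station 1,
      [L_p(x,y) = P_p(x,0) + p (P_p(x,y) - P_p(x,0) - P_p(0,y) + P_p(0,0))].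
    Two facts make all coefficients of the expansion accessible.

    The idle probability [P_p(0,0)] does not depend on [p]
    ([idle_probability]): in equilibrium each station is busy, counted in
    full-capacity units, for its arrival rate divided by its service rate,
    however the capacity is shared.  Analytically, divide the functional
    equation by [1 - x] on [y = 1] and by [1 - y] on [x = 1], then let the
    variable tend to [1].

    The number [Y = Ytilde x] lies in the closed unit disc and satisfies
    [G(x,Y) = 0], so [k(x,Y) L_p(x,Y) = - nu1 Y (x - Y) P_p(0,0)], whose right
    side does not depend on [p].  Hence [L_p(x,Y)] does not depend on [p] where
    [k(x,Y)] does not vanish, and stability makes [x = 1] the only zero of
    [k(x,Y)] in the closed unit disc ([kernel_zero]); there [L_p(1,1)] is known
    from the flow balance.  As [L_p(x,y)] and [L_p(x,Y)] differ by [p Q], with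
    [Q] the mixed difference of [P_p] between [y] and [Y], subtracting the
    functional equation at parameter [0] leaves
      [G(x,y) (P_p(x,y) - P_0(x,y)) = p G10(x,y) Q]
    ([coupling_identity]).  Comparing coefficients of the powers of [p] gives
    the recursion for positive orders, and [p = 0], where [L_0(x,y) = P_0(x,0)],
    gives the order-zero formula.  The functional equation is void at [x = 0];
    there the balance of the row of states with station 1 empty, solved by the
    same substitution [y = Y], replaces it. *)

Open Scope R_scope.

(** * Sums over the state space *)

Definition prepend {T : Type} (z : T) (f : nat -> T) (n : nat) : T :=
  match n with O => z | S m => f m end.

Lemma is_series_zero_R : is_series (fun _ : nat => 0%R) 0%R.
Proof.
intros P HP; exists 0%nat; intros n _.
replace (sum_n _ n) with 0; [exact (locally_singleton _ _ HP)|].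
rewrite sum_n_const; ring.
Qed.

Lemma is_series_single (m : nat) (r : R) :
  is_series (fun n => if Nat.eq_dec n m then r else 0) r.
Proof.
induction m as [|m IH].
- apply is_series_decr_1; simpl.
  change (is_series (fun _ : nat => 0) (r + - r)).
  rewrite Rplus_opp_r; exact is_series_zero_R.
- apply is_series_decr_1.
  destruct (Nat.eq_dec 0 (S m)) as [e|_]; [discriminate|].
  change (is_series (fun n => if Nat.eq_dec (S n) (S m) then r else 0) (r + - 0)).
  rewrite Ropp_0, Rplus_0_r.
  revert IH; apply is_series_ext; intros n.
  destruct (Nat.eq_dec n m), (Nat.eq_dec (S n) (S m)); trivial; lia.
Qed.

Lemma is_state_sum_ext (f g : state -> R) (l : R) :
  (forall s, f s = g s) -> is_state_sum f l -> is_state_sum g l.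
Proof.
intros H [row [Hr Hs]]; exists row; split; trivial.
intros i n; apply is_series_ext with (2 := Hr i n); intros k; apply H.
Qed.

(** Inner sums determine the rows, so the witness of the existential does not
    influence the value. *)
Lemma is_state_sum_unique (f : state -> R) (l1 l2 : R) :
  is_state_sum f l1 -> is_state_sum f l2 -> l1 = l2.
Proof.
intros [row1 [Hr1 Hs1]] [row2 [Hr2 Hs2]].
rewrite <- (is_series_unique _ _ Hs1), <- (is_series_unique _ _ Hs2).
apply Series_ext; intros n.
rewrite <- !(is_series_unique _ _ (Hr1 _ n)), <- !(is_series_unique _ _ (Hr2 _ n)).
reflexivity.
Qed.

Lemma is_state_sum_zero : is_state_sum (fun _ => 0) 0.
Proof.
exists (fun _ _ => 0); split.
- intros _ _; apply is_series_zero_R.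
- apply is_series_ext with (2 := is_series_zero_R).
  intros n; symmetry; apply Rplus_0_l.
Qed.

Lemma is_state_sum_plus (f g : state -> R) (lf lg : R) :
  is_state_sum f lf -> is_state_sum g lg ->
  is_state_sum (fun s => f s + g s) (lf + lg).
Proof.
intros [row1 [Hr1 Hs1]] [row2 [Hr2 Hs2]].
exists (fun i n => row1 i n + row2 i n); split.
- intros i n; apply (is_series_plus _ _ _ _ (Hr1 i n) (Hr2 i n)).
- apply is_series_ext with (2 := is_series_plus _ _ _ _ Hs1 Hs2).
  intros n; unfold plus; simpl; ring.
Qed.

Lemma is_state_sum_jump (t : state) (r : R) : is_state_sum (jump t r) r.
Proof.
destruct t as [[i n] k].
assert (Z : forall j m, (j, m) <> (i, n) ->
            is_series (fun l => jump (i, n, k) r (j, m, l)) 0).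
{ intros j m H; apply is_series_ext with (2 := is_series_zero_R).
  intros l; unfold jump; destruct (state_eq_dec _ _); congruence. }
assert (One : is_series (fun l => jump (i, n, k) r (i, n, l)) r).
{ apply is_series_ext with (2 := is_series_single k r).
  intros l; unfold jump.
  destruct (state_eq_dec _ _), (Nat.eq_dec l k); congruence. }
exists (fun j m => match i, j with
                   | Operating, Operating | Setup, Setup =>
                       if Nat.eq_dec m n then r else 0
                   | _, _ => 0 end); split.
- intros j m; destruct i, j; try (apply Z; congruence);
  (destruct (Nat.eq_dec m n) as [->|Hm]; [apply One | apply Z; congruence]).
- apply is_series_ext with (2 := is_series_single n r).
  intros m; symmetry; destruct i; [apply Rplus_0_r | apply Rplus_0_l].
Qed.

Lemma jump_0 (t s : state) : jump t 0 s = 0.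
Proof. unfold jump; destruct (state_eq_dec _ _); trivial. Qed.

(** * Pointwise balance equations *)

(** Total service rates of the two stations, so that the four service cases of
    the generator become two uniform jumps. *)
Definition serv1 (a : params) (p : R) (n k : nat) : R :=
  match n, k with
  | S _, S _ => p * nu1 a
  | S _, O => nu1 a
  | O, _ => 0
  end.

Definition serv2 (a : params) (p : R) (n k : nat) : R :=
  match n, k with
  | S _, S _ => (1 - p) * nu2 a
  | O, S _ => nu2 a
  | _, O => 0
  end.

(** The truncated predecessors are harmless: they are reached only with rate
    zero. *)
Lemma rate_Operating (a : params) (p : R) (n k : nat) (t : state) :
  rate a p (Operating, n, k) t
  = jump (Operating, S n, k) (lam0 a) t + jump (Setup, n, k) (gam a) t
    + jump (Operating, Nat.pred n, S k) (serv1 a p n k) t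
    + jump (Operating, n, Nat.pred k) (serv2 a p n k) t.
Proof. destruct n, k; simpl; rewrite ?jump_0; ring. Qed.

(** Turns the inflow into a fixed state, a sum over sources of jumps hitting a
    given target, into a combination of jump functions of the source, which are
    the functions that state sums can evaluate. *)
Lemma jump_flip (s t s' t' : state) (r r' m : R) :
  (t' = t <-> s' = s) -> (s' = s -> m * r = r') ->
  m * jump t' r t = jump s' r' s.
Proof.
intros E H; unfold jump.
destruct (state_eq_dec t t') as [e|e], (state_eq_dec s s') as [e'|e'].
- apply H; congruence.
- exfalso; apply e'; symmetry; apply E; congruence.
- exfalso; apply e; symmetry; apply E; congruence.
- ring.
Qed.

Lemma jump_neq (t s : state) (r : R) : s <> t -> jump t r s = 0.
Proof. intros H; unfold jump; destruct (state_eq_dec _ _); congruence. Qed.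

Section Balance.
Variables (a : params) (p : R) (mu : state -> R).
Hypothesis Hst : is_stationary (rate a p) mu.

Lemma balance_of_sums (t : state) (out inn : R) :
  is_state_sum (rate a p t) out ->
  is_state_sum (fun s => mu s * rate a p s t) inn ->
  mu t * out = inn.
Proof.
intros Ho Hi; destruct (stat_balance _ _ Hst t) as [o [Ho' Hi']].
rewrite (is_state_sum_unique _ _ _ Ho Ho').
apply (is_state_sum_unique _ _ _ Hi' Hi).
Qed.

Lemma is_state_sum_prepend (n : nat) (f : nat -> state -> R) (l : nat -> R) :
  (forall m, is_state_sum (f m) (l m)) ->
  is_state_sum (fun s => prepend 0 (fun m => f m s) n) (prepend 0 l n).
Proof. intros H; destruct n; simpl; [apply is_state_sum_zero | apply H]. Qed.

Lemma balance_Setup (n k : nat) :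
  mu (Setup, n, k) * (lam1 a + tau a)
  = prepend 0 (fun m => lam1 a * mu (Setup, m, k)) n + gam a * mu (Operating, n, k).
Proof.
apply balance_of_sums with (t := (Setup, n, k)).
- apply (is_state_sum_plus (jump _ _) (jump _ _)); apply is_state_sum_jump.
- eapply is_state_sum_ext; cycle 1.
  + apply is_state_sum_plus.
    * apply (is_state_sum_prepend n (fun m => jump (Setup, m, k) (lam1 a * mu (Setup, m, k)))).
      intros m; apply is_state_sum_jump.
    * apply (is_state_sum_jump (Operating, n, k)).
  + intros [[[] m] l]; symmetry.
    * rewrite rate_Operating.
      rewrite (jump_neq (Operating, S m, l)), (jump_neq (Operating, Nat.pred m, S l)),
        (jump_neq (Operating, m, Nat.pred l)) by congruence.
      replace (prepend _ _ _) with 0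
        by (destruct n; trivial; symmetry; apply jump_neq; congruence).
      rewrite Rplus_0_l, !Rplus_0_r, Rplus_0_l.
      apply jump_flip; [split; congruence|].
      intros E; injection E as -> ->; ring.
    * change (rate a p (Setup, m, l) (Setup, n, k)) with
        (jump (Setup, S m, l) (lam1 a) (Setup, n, k)
         + jump (Operating, m, l) (tau a) (Setup, n, k)).
      rewrite (jump_neq (Operating, m, l)), (jump_neq (Operating, n, k)) by congruence.
      rewrite !Rplus_0_r.
      destruct n as [|n]; simpl.
      { rewrite jump_neq by congruence; ring. }
      apply jump_flip; [split; congruence|].
      intros E; injection E as -> ->; ring.
Qed.

Lemma balance_Operating (n k : nat) :
  mu (Operating, n, k) * (lam0 a + gam a + serv1 a p n k + serv2 a p n k)
  = prepend 0 (fun m => lam0 a * mu (Operating, m, k)) n + tau a * mu (Setup, n, k)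
    + prepend 0 (fun l => serv1 a p (S n) l * mu (Operating, S n, l)) k
    + serv2 a p n (S k) * mu (Operating, n, S k).
Proof.
apply balance_of_sums with (t := (Operating, n, k)).
- eapply is_state_sum_ext.
  + intros s; symmetry; apply rate_Operating.
  + repeat (apply is_state_sum_plus; [| apply is_state_sum_jump]).
    apply is_state_sum_jump.
- eapply is_state_sum_ext; cycle 1.
  + apply is_state_sum_plus; [apply is_state_sum_plus; [apply is_state_sum_plus|]|].
    * apply (is_state_sum_prepend n
        (fun m => jump (Operating, m, k) (lam0 a * mu (Operating, m, k)))).
      intros m; apply is_state_sum_jump.
    * apply (is_state_sum_jump (Setup, n, k)).
    * apply (is_state_sum_prepend k
        (fun l => jump (Operating, S n, l) (serv1 a p (S n) l * mu (Operating, S n, l)))).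
      intros m; apply is_state_sum_jump.
    * apply (is_state_sum_jump (Operating, n, S k)).
  + intros [[[] m] l]; symmetry.
    * rewrite rate_Operating.
      rewrite (jump_neq (Setup, m, l)), (jump_neq (Setup, n, k)) by congruence.
      rewrite !Rplus_0_r, !Rmult_plus_distr_l.
      f_equal; [f_equal|].
      -- destruct n as [|n]; simpl.
         { rewrite jump_neq by congruence; ring. }
         apply jump_flip; [split; congruence|].
         intros E; injection E as -> ->; ring.
      -- destruct k as [|k]; simpl.
         { rewrite jump_neq by congruence; ring. }
         destruct m as [|m]; simpl.
         { rewrite jump_0, jump_neq by congruence; ring. }
         apply jump_flip; [split; congruence|].
         intros E; injection E as -> ->; ring.
      -- destruct l as [|l]; simpl.
         { replace (serv2 a p m 0) with 0 by (destruct m; reflexivity).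
           rewrite jump_0, jump_neq by congruence; ring. }
         apply jump_flip; [split; congruence|].
         intros E; injection E as -> ->; ring.
    * change (rate a p (Setup, m, l) (Operating, n, k)) with
        (jump (Setup, S m, l) (lam1 a) (Operating, n, k)
         + jump (Operating, m, l) (tau a) (Operating, n, k)).
      rewrite (jump_neq (Setup, S m, l)), (jump_neq (Operating, n, S k)) by congruence.
      replace (prepend 0 (fun m0 => jump (Operating, m0, k) _ _) n) with 0
        by (destruct n; trivial; symmetry; apply jump_neq; congruence).
      replace (prepend 0 (fun m0 => jump (Operating, S n, m0) _ _) k) with 0
        by (destruct k; trivial; symmetry; apply jump_neq; congruence).
      rewrite !Rplus_0_l, !Rplus_0_r.
      apply jump_flip; [split; congruence|].
      intros E; injection E as -> ->; ring.
Qed.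

End Balance.

(** * Complex series *)

Open Scope R_scope.
Open Scope C_scope.

Definition is_Cseries (u : nat -> C) (l : C) : Prop :=
  is_series (K := C_AbsRing) (V := C_NormedModule) u l.

Lemma Re_sum_n (u : nat -> C) (N : nat) :
  Re (sum_n (G := C_NormedModule) u N) = sum_n (fun n => Re (u n)) N.
Proof.
induction N as [|N IH]; [now rewrite !sum_O|].
rewrite !sum_Sn, <- IH; reflexivity.
Qed.

Lemma Im_sum_n (u : nat -> C) (N : nat) :
  Im (sum_n (G := C_NormedModule) u N) = sum_n (fun n => Im (u n)) N.
Proof.
induction N as [|N IH]; [now rewrite !sum_O|].
rewrite !sum_Sn, <- IH; reflexivity.
Qed.

Lemma is_Cseries_Re (u : nat -> C) (l : C) :
  is_Cseries u l -> is_series (fun n => Re (u n)) (Re l).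
Proof.
intros H.
apply filterlim_ext with (fun N => fst (sum_n (G := C_NormedModule) u N)).
  intros N; apply Re_sum_n.
apply filterlim_comp with (1 := H).
apply (continuous_fst (U := R_UniformSpace) (V := R_UniformSpace)).
Qed.

Lemma is_Cseries_Im (u : nat -> C) (l : C) :
  is_Cseries u l -> is_series (fun n => Im (u n)) (Im l).
Proof.
intros H.
apply filterlim_ext with (fun N => snd (sum_n (G := C_NormedModule) u N)).
  intros N; apply Im_sum_n.
apply filterlim_comp with (1 := H).
apply (continuous_snd (U := R_UniformSpace) (V := R_UniformSpace)).
Qed.

Lemma is_Cseries_unique (u : nat -> C) (l : C) : is_Cseries u l -> CSeries u = l.
Proof.
intros H; destruct l as [a b]; unfold CSeries; f_equal; apply is_series_unique.
- apply (is_Cseries_Re _ _ H).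
- apply (is_Cseries_Im _ _ H).
Qed.

(** How balance equations pass to generating functions: two series with equal
    terms and known sums. *)
Lemma is_Cseries_eq (u v : nat -> C) (k l : C) :
  (forall n, u n = v n) -> is_Cseries u k -> is_Cseries v l -> k = l.
Proof.
intros E Hu Hv.
rewrite <- (is_Cseries_unique _ _ Hv).
symmetry; apply is_Cseries_unique.
apply is_series_ext with (2 := Hu); exact E.
Qed.

Lemma is_Cseries_dominated (u : nat -> C) (b : nat -> R) :
  (forall n, (Cmod (u n) <= b n)%R) -> ex_series b ->
  is_Cseries u (CSeries u) /\ (Cmod (CSeries u) <= Series b)%R.
Proof.
intros Hu Hb.
destruct (ex_series_le (V := C_CompleteNormedModule) u b Hu Hb) as [l Hl].
rewrite (is_Cseries_unique u l Hl); split; [exact Hl|].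
assert (H1 : is_lim_seq (fun N => Cmod (sum_n (G := C_NormedModule) u N)) (Cmod l)).
{ apply (filterlim_comp _ _ _ _ _ _ _ _ Hl (filterlim_norm (V := C_NormedModule) l)). }
apply (is_lim_seq_le _ (sum_n b) _ (Series b)) with (2 := H1).
- intros N; eapply Rle_trans; [apply (norm_sum_n_m (V := C_NormedModule))|].
  apply sum_n_m_le; exact Hu.
- exact (Series_correct _ Hb).
Qed.

Lemma is_Cseries_plus (u v : nat -> C) (k l : C) :
  is_Cseries u k -> is_Cseries v l -> is_Cseries (fun n => u n + v n) (k + l).
Proof. exact (is_series_plus (V := C_NormedModule) u v k l). Qed.

Lemma is_Cseries_scal (c : C) (u : nat -> C) (l : C) :
  is_Cseries u l -> is_Cseries (fun n => c * u n) (c * l).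
Proof. exact (is_series_scal (V := C_NormedModule) c u l). Qed.

Lemma is_Cseries_shift (u : nat -> C) (l : C) :
  is_Cseries u l -> is_Cseries (fun n => u (S n)) (l - u 0%nat).
Proof.
intros H; apply (is_series_incr_1 (V := C_NormedModule)).
replace (plus (l - u 0%nat : C_NormedModule) (u 0%nat)) with l; [exact H|].
change (l = l - u 0%nat + u 0%nat); ring.
Qed.

Lemma is_Cseries_unshift (u : nat -> C) (l : C) :
  is_Cseries (fun n => u (S n)) l -> is_Cseries u (u 0%nat + l).
Proof.
intros H; apply (is_series_decr_1 (V := C_NormedModule)).
change (is_Cseries (fun n => u (S n)) (u 0%nat + l - u 0%nat)).
replace (u 0%nat + l - u 0%nat) with l by ring; exact H.
Qed.

Lemma is_Cseries_zero : is_Cseries (fun _ => 0) 0.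
Proof.
intros P HP; exists 0%nat; intros N _.
replace (sum_n _ N) with (0 : C); [exact (locally_singleton _ _ HP)|].
induction N as [|N IH]; [now rewrite sum_O|].
rewrite sum_Sn, <- IH; symmetry; exact (Cplus_0_l 0).
Qed.

(** Service rates take one value on an empty queue and another on all nonempty
    ones, so all of them act on generating functions through this lemma. *)
Lemma is_Cseries_head_weight (al be : C) (f : nat -> C) (l : C) :
  is_Cseries f l ->
  is_Cseries (fun n => match n with O => al | S _ => be end * f n)
    (be * (l - f 0%nat) + al * f 0%nat).
Proof.
intros H; rewrite Cplus_comm.
apply (is_Cseries_unshift (fun n => match n with O => al | S _ => be end * f n)).
apply is_Cseries_scal, is_Cseries_shift, H.
Qed.

Lemma is_Cseries_at_0 (u : nat -> C) : is_Cseries (fun n => u n * 0 ^ n) (u 0%nat).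
Proof.
replace (u 0%nat) with (u 0%nat * 0 ^ 0 + 0) by (simpl; ring).
apply (is_Cseries_unshift (fun n => u n * 0 ^ n)).
apply is_series_ext with (2 := is_Cseries_zero).
intros n; symmetry; rewrite Cpow_S; change (u (S n) * (0 * 0 ^ n) = 0); ring.
Qed.

Lemma is_Cseries_pow_shift (u : nat -> C) (x l : C) :
  is_Cseries (fun n => u n * x ^ n) l ->
  is_Cseries (fun n => prepend (RtoC 0) u n * x ^ n) (x * l).
Proof.
intros H.
replace (x * l) with (0 * x ^ 0 + x * l) by (simpl; ring).
apply (is_Cseries_unshift (fun n => prepend (RtoC 0) u n * x ^ n)).
apply is_series_ext with (2 := is_Cseries_scal x _ _ H).
intros n; rewrite Cpow_S; change (x * (u n * x ^ n) = u n * (x * x ^ n)); ring.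
Qed.

(** * Generating functions of summable arrays *)

(** Exactly what a stationary distribution provides in one mode; nonnegativity
    makes the iterated sums dominate the generating function on the closed
    bidisc. *)
Definition summable_array (f : nat -> nat -> R) : Prop :=
  (forall n k, (0 <= f n k)%R) /\
  exists r : nat -> R, (forall n, is_series (f n) (r n)) /\ ex_series r.

Definition row_gf (f : nat -> nat -> R) (n : nat) (y : C) : C :=
  CSeries (fun k => RtoC (f n k) * y ^ k).

Definition array_gf (f : nat -> nat -> R) (x y : C) : C :=
  CSeries (fun n => CSeries (fun k => RtoC (f n k) * x ^ n * y ^ k)).

Lemma Cmod_pow_le_1 (x : C) (n : nat) : (Cmod x <= 1 -> Cmod (x ^ n) <= 1)%R.
Proof.
intros H; rewrite Cmod_pow; rewrite <- (pow1 n); apply pow_incr.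
split; [apply Cmod_ge_0 | exact H].
Qed.

Lemma Cmod_weight_le (r : R) (w : C) :
  (0 <= r -> Cmod w <= 1 -> Cmod (RtoC r * w) <= r)%R.
Proof.
intros Hr Hw; rewrite Cmod_mult, Cmod_R, Rabs_pos_eq by exact Hr.
pose proof (Cmod_ge_0 w); nra.
Qed.

Lemma row_gf_dominated (f : nat -> nat -> R) (n : nat) (y : C) :
  summable_array f -> (Cmod y <= 1)%R ->
  is_Cseries (fun k => RtoC (f n k) * y ^ k) (row_gf f n y) /\
  (Cmod (row_gf f n y) <= Series (f n))%R.
Proof.
intros [Hf [r [Hr _]]] Hy; apply is_Cseries_dominated.
- intros k; apply Cmod_weight_le; [apply Hf | apply Cmod_pow_le_1, Hy].
- exists (r n); apply Hr.
Qed.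

Lemma array_gf_series (f : nat -> nat -> R) (x y : C) :
  summable_array f -> (Cmod x <= 1)%R -> (Cmod y <= 1)%R ->
  is_Cseries (fun n => row_gf f n y * x ^ n) (array_gf f x y).
Proof.
intros Hs Hx Hy.
assert (E : forall n, CSeries (fun k => RtoC (f n k) * x ^ n * y ^ k)
                      = row_gf f n y * x ^ n).
{ intros n; apply is_Cseries_unique.
  destruct (row_gf_dominated f n y Hs Hy) as [H _].
  rewrite Cmult_comm.
  apply is_series_ext with (2 := is_Cseries_scal (x ^ n) _ _ H).
  intros k; change (x ^ n * (RtoC (f n k) * y ^ k) = RtoC (f n k) * x ^ n * y ^ k); ring. }
destruct Hs as [Hf [r [Hr Hr']]].
apply is_series_ext with (1 := E).
apply is_Cseries_dominated with r; [|exact Hr'].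
intros n; rewrite E, Cmod_mult.
destruct (row_gf_dominated f n y) as [_ H]; [split; eauto | exact Hy |].
rewrite (is_series_unique _ _ (Hr n)) in H.
pose proof (Cmod_pow_le_1 x n Hx); pose proof (Cmod_ge_0 (x ^ n)).
pose proof (Cmod_ge_0 (row_gf f n y)); nra.
Qed.

Lemma row_gf_0 (f : nat -> nat -> R) (n : nat) : row_gf f n 0 = RtoC (f n 0%nat).
Proof. apply is_Cseries_unique, (is_Cseries_at_0 (fun k => RtoC (f n k))). Qed.

Lemma Cmod_0_le_1 : (Cmod 0 <= 1)%R.
Proof. rewrite Cmod_0; lra. Qed.

Lemma array_gf_0_l (f : nat -> nat -> R) (y : C) :
  summable_array f -> (Cmod y <= 1)%R -> array_gf f 0 y = row_gf f 0 y.
Proof.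
intros Hs Hy.
apply (is_Cseries_eq (fun n => row_gf f n y * 0 ^ n) (fun n => row_gf f n y * 0 ^ n)).
- reflexivity.
- apply array_gf_series; [exact Hs | exact Cmod_0_le_1 | exact Hy].
- apply (is_Cseries_at_0 (fun n => row_gf f n y)).
Qed.

(** * Generating functions of a stationary distribution *)

Open Scope R_scope.
Open Scope C_scope.

Definition mode_array (mu : state -> R) (i : mode) (n k : nat) : R := mu (i, n, k).

Lemma stationary_summable (q : state -> state -> R) (mu : state -> R) (i : mode) :
  is_stationary q mu -> summable_array (mode_array mu i).
Proof.
intros H; split; [intros n k; apply (stat_nonneg _ _ H)|].
destruct (stat_mass _ _ H) as [r [Hr Hs]].
exists (r i); split; [apply Hr|].
assert (P : forall j n, (0 <= r j n)%R).
{ intros j n; rewrite <- (is_series_unique _ _ (Hr j n)).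
  rewrite <- (is_series_unique _ _ is_series_zero_R).
  apply Series_le; [|eexists; apply Hr].
  intros k; split; [lra | apply (stat_nonneg _ _ H)]. }
apply (ex_series_le (V := R_CompleteNormedModule) (r i)
         (fun n => (r Operating n + r Setup n)%R)); [|eexists; apply Hs].
intros n; change (Rabs (r i n) <= r Operating n + r Setup n)%R.
rewrite Rabs_pos_eq by apply P.
pose proof (P Operating n); pose proof (P Setup n); destruct i; lra.
Qed.

Definition serv1_row (a : params) (p : R) (f : nat -> nat -> R) (n : nat) (y : C) : C :=
  match n with O => 0 | S _ => 1 end
  * (p * nu1 a * row_gf f n y + (1 - p) * nu1 a * f n 0%nat).

Definition serv2_row (a : params) (p : R) (f : nat -> nat -> R) (n : nat) (y : C) : C :=
  match n with O => RtoC (nu2 a) | S _ => (1 - p) * nu2 a end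
  * (row_gf f n y - f n 0%nat).

Lemma serv1_row_series (a : params) (p : R) (f : nat -> nat -> R) (n : nat) (y : C) :
  summable_array f -> (Cmod y <= 1)%R ->
  is_Cseries (fun k => RtoC (serv1 a p n k * f n k) * y ^ k) (serv1_row a p f n y).
Proof.
intros Hs Hy; destruct (row_gf_dominated f n y Hs Hy) as [H _].
unfold serv1_row; destruct n as [|n].
- rewrite Cmult_0_l; apply is_series_ext with (2 := is_Cseries_zero).
  intros k; simpl; rewrite Rmult_0_l; symmetry; apply Cmult_0_l.
- apply is_Cseries_head_weight with (al := RtoC (nu1 a)) (be := p * nu1 a) in H.
  replace (1 * _) with
    (p * nu1 a * (row_gf f (S n) y - RtoC (f (S n) 0%nat) * y ^ 0)
     + RtoC (nu1 a) * (RtoC (f (S n) 0%nat) * y ^ 0)) by (simpl; ring).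
  apply is_series_ext with (2 := H).
  intros k; destruct k; simpl serv1; rewrite !RtoC_mult; apply Cmult_assoc.
Qed.

Lemma serv2_row_series (a : params) (p : R) (f : nat -> nat -> R) (n : nat) (y : C) :
  summable_array f -> (Cmod y <= 1)%R ->
  is_Cseries (fun k => RtoC (serv2 a p n k * f n k) * y ^ k) (serv2_row a p f n y).
Proof.
intros Hs Hy; destruct (row_gf_dominated f n y Hs Hy) as [H _].
set (be := match n with O => RtoC (nu2 a) | S _ => (1 - p) * nu2 a end).
apply is_Cseries_head_weight with (al := RtoC 0) (be := be) in H.
replace (serv2_row a p f n y) with
    (be * (row_gf f n y - RtoC (f n 0%nat) * y ^ 0)
     + 0 * (RtoC (f n 0%nat) * y ^ 0)) by (unfold serv2_row; fold be; simpl; ring).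
apply is_series_ext with (2 := H).
intros k; unfold be; destruct n, k; simpl serv2; rewrite ?RtoC_mult, ?RtoC_minus;
  apply Cmult_assoc.
Qed.

Lemma row_series_head_weight (al be : C) (f : nat -> nat -> R) (x y : C) :
  summable_array f -> (Cmod x <= 1)%R -> (Cmod y <= 1)%R ->
  is_Cseries
    (fun n => match n with O => al | S _ => be end * row_gf f n y * x ^ n)
    (be * (array_gf f x y - array_gf f 0 y) + al * array_gf f 0 y).
Proof.
intros Hs Hx Hy.
assert (H := is_Cseries_head_weight al be _ _ (array_gf_series f x y Hs Hx Hy)).
cbn beta in H; rewrite <- array_gf_0_l in H by assumption.
replace (array_gf f 0 y * x ^ 0) with (array_gf f 0 y) in H by (simpl; ring).
apply is_series_ext with (2 := H); intros n; apply Cmult_assoc.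
Qed.

Definition interior_gf (f : nat -> nat -> R) (x y : C) : C :=
  array_gf f x y - array_gf f x 0 - array_gf f 0 y + array_gf f 0 0.

(** Up to the constant term at the origin, the capacity that station 1 receives:
    all of it when station 2 is empty, the share [p] when both are busy. *)
Definition load1 (p : R) (f : nat -> nat -> R) (x y : C) : C :=
  array_gf f x 0 + p * interior_gf f x y.

Definition serv1_gf (a : params) (p : R) (f : nat -> nat -> R) (x y : C) : C :=
  nu1 a * (load1 p f x y - array_gf f 0 0).

(** Capacity not used by station 1 and not idle goes to station 2, hence the
    complement of [load1]. *)
Definition serv2_gf (a : params) (p : R) (f : nat -> nat -> R) (x y : C) : C :=
  nu2 a * (array_gf f x y - load1 p f x y).

Lemma serv1_gf_series (a : params) (p : R) (f : nat -> nat -> R) (x y : C) :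
  summable_array f -> (Cmod x <= 1)%R -> (Cmod y <= 1)%R ->
  is_Cseries (fun n => serv1_row a p f n y * x ^ n) (serv1_gf a p f x y).
Proof.
intros Hs Hx Hy.
assert (H := is_Cseries_plus _ _ _ _
  (is_Cseries_scal (p * nu1 a) _ _ (row_series_head_weight (RtoC 0) (RtoC 1) f x y Hs Hx Hy))
  (is_Cseries_scal ((1 - p) * nu1 a) _ _
    (row_series_head_weight (RtoC 0) (RtoC 1) f x 0 Hs Hx Cmod_0_le_1))).
replace (serv1_gf a p f x y) with
  (p * nu1 a * (1 * (array_gf f x y - array_gf f 0 y) + 0 * array_gf f 0 y)
   + (1 - p) * nu1 a * (1 * (array_gf f x 0 - array_gf f 0 0) + 0 * array_gf f 0 0))
  by (unfold serv1_gf, load1, interior_gf; ring).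
apply is_series_ext with (2 := H).
intros n; unfold serv1_row; rewrite row_gf_0; destruct n;
  match goal with |- ?l = ?r => change (l = r :> C) end; cbv beta iota; ring.
Qed.

Lemma serv2_gf_series (a : params) (p : R) (f : nat -> nat -> R) (x y : C) :
  summable_array f -> (Cmod x <= 1)%R -> (Cmod y <= 1)%R ->
  is_Cseries (fun n => serv2_row a p f n y * x ^ n) (serv2_gf a p f x y).
Proof.
intros Hs Hx Hy.
set (al := RtoC (nu2 a)); set (be := (1 - p) * nu2 a).
assert (H := is_Cseries_plus _ _ _ _
  (row_series_head_weight al be f x y Hs Hx Hy)
  (is_Cseries_scal (- RtoC 1) _ _
    (row_series_head_weight al be f x 0 Hs Hx Cmod_0_le_1))).
replace (serv2_gf a p f x y) with
  (be * (array_gf f x y - array_gf f 0 y) + al * array_gf f 0 y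
   + - RtoC 1 * (be * (array_gf f x 0 - array_gf f 0 0) + al * array_gf f 0 0))
  by (unfold serv2_gf, load1, interior_gf, al, be; ring).
apply is_series_ext with (2 := H).
intros n; unfold serv2_row, al, be; rewrite row_gf_0; destruct n;
  match goal with |- ?l = ?r => change (l = r :> C) end; cbv beta iota; ring.
Qed.

Lemma prepend_row_series (f : nat -> nat -> R) (c : R) (x y : C) :
  summable_array f -> (Cmod x <= 1)%R -> (Cmod y <= 1)%R ->
  is_Cseries (fun n => prepend (RtoC 0) (fun m => c * row_gf f m y) n * x ^ n)
    (x * (c * array_gf f x y)).
Proof.
intros Hs Hx Hy.
apply (is_Cseries_pow_shift (fun m => c * row_gf f m y)).
apply is_series_ext with (2 := is_Cseries_scal c _ _ (array_gf_series f x y Hs Hx Hy)).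
intros n; apply Cmult_assoc.
Qed.

Section Stationary.
Variables (a : params) (p : R) (mu : state -> R).
Hypothesis Hst : is_stationary (rate a p) mu.

Let f0 := mode_array mu Operating.
Let f1 := mode_array mu Setup.

Let Hs0 : summable_array f0 := stationary_summable _ _ Operating Hst.
Let Hs1 : summable_array f1 := stationary_summable _ _ Setup Hst.

Lemma prepend_series (f : nat -> nat -> R) (c : R) (n : nat) (y : C) :
  summable_array f -> (Cmod y <= 1)%R ->
  is_Cseries (fun k => RtoC (prepend 0 (fun m => (c * f m k)%R) n) * y ^ k)
    (prepend (RtoC 0) (fun m => c * row_gf f m y) n).
Proof.
intros Hs Hy; destruct n as [|n]; simpl.
- apply is_series_ext with (2 := is_Cseries_zero).
  intros k; symmetry; apply Cmult_0_l.
- destruct (row_gf_dominated f n y Hs Hy) as [H _].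
  apply is_series_ext with (2 := is_Cseries_scal c _ _ H).
  intros k; rewrite RtoC_mult; apply Cmult_assoc.
Qed.

Lemma row_balance_Setup (n : nat) (y : C) :
  (Cmod y <= 1)%R ->
  (lam1 a + tau a) * row_gf f1 n y
  = prepend (RtoC 0) (fun m => lam1 a * row_gf f1 m y) n + gam a * row_gf f0 n y.
Proof.
intros Hy.
eapply is_Cseries_eq; cycle 1.
- apply is_Cseries_scal; apply (row_gf_dominated f1 n y Hs1 Hy).
- apply is_Cseries_plus.
  + apply (prepend_series f1 (lam1 a) n y Hs1 Hy).
  + apply is_Cseries_scal; apply (row_gf_dominated f0 n y Hs0 Hy).
- intros k; simpl.
  rewrite Cmult_assoc, (Cmult_assoc (gam a)), <- Cmult_plus_distr_r.
  f_equal; rewrite <- RtoC_plus, <- !RtoC_mult, <- RtoC_plus; f_equal.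
  rewrite Rmult_comm; apply (balance_Setup a p mu Hst).
Qed.

(** Multiplied by [y], since departures from station 2 lower the exponent of [y];
    the equation of the row [n = 0] is used on its own when [x = 0]. *)
Lemma row_balance_Operating (n : nat) (y : C) :
  (Cmod y <= 1)%R ->
  y * ((lam0 a + gam a) * row_gf f0 n y + serv1_row a p f0 n y + serv2_row a p f0 n y)
  = y * (prepend (RtoC 0) (fun m => lam0 a * row_gf f0 m y) n + tau a * row_gf f1 n y
         + y * serv1_row a p f0 (S n) y)
    + serv2_row a p f0 n y.
Proof.
intros Hy.
eapply is_Cseries_eq; cycle 1.
- apply is_Cseries_scal; apply is_Cseries_plus; [apply is_Cseries_plus|].
  + apply is_Cseries_scal; apply (row_gf_dominated f0 n y Hs0 Hy).
  + apply (serv1_row_series a p f0 n y Hs0 Hy).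
  + apply (serv2_row_series a p f0 n y Hs0 Hy).
- apply is_Cseries_plus.
  + apply is_Cseries_scal; apply is_Cseries_plus; [apply is_Cseries_plus|].
    * apply (prepend_series f0 (lam0 a) n y Hs0 Hy).
    * apply is_Cseries_scal; apply (row_gf_dominated f1 n y Hs1 Hy).
    * apply (is_Cseries_pow_shift (fun l => RtoC (serv1 a p (S n) l * f0 (S n) l))).
      apply (serv1_row_series a p f0 (S n) y Hs0 Hy).
  (* an empty station 2 has no services, so dropping [k = 0] loses nothing *)
  + replace (serv2_row a p f0 n y)
      with (serv2_row a p f0 n y - RtoC (serv2 a p n 0 * f0 n 0%nat) * y ^ 0).
    * apply is_Cseries_shift with (u := fun k => RtoC (serv2 a p n k * f0 n k) * y ^ k).
      apply (serv2_row_series a p f0 n y Hs0 Hy).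
    * replace (serv2 a p n 0) with 0%R by (destruct n; reflexivity).
      rewrite Rmult_0_l; ring.
- intros k; cbn beta; rewrite Cpow_S.
  assert (E := balance_Operating a p mu Hst n k).
  apply (f_equal RtoC) in E.
  unfold f0, f1, mode_array.
  replace (prepend (RtoC 0) (fun l => RtoC (serv1 a p (S n) l * mu (Operating, S n, l))) k)
    with (RtoC (prepend 0 (fun l => serv1 a p (S n) l * mu (Operating, S n, l))%R k))
    by (destruct k; reflexivity).
  repeat (rewrite RtoC_plus in E || rewrite RtoC_mult in E).
  rewrite !RtoC_mult.
  transitivity (y * y ^ k * (mu (Operating, n, k) *
    (lam0 a + gam a + serv1 a p n k + serv2 a p n k))); [ring|].
  rewrite E. ring.
Qed.

Lemma gf_balance_Setup (x y : C) :
  (Cmod x <= 1)%R -> (Cmod y <= 1)%R ->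
  D a x * array_gf f1 x y = gam a * array_gf f0 x y.
Proof.
intros Hx Hy.
assert (E : (lam1 a + tau a) * array_gf f1 x y
            = x * (lam1 a * array_gf f1 x y) + gam a * array_gf f0 x y).
{ eapply is_Cseries_eq; cycle 1.
  - apply is_Cseries_scal; apply (array_gf_series f1 x y Hs1 Hx Hy).
  - apply is_Cseries_plus.
    + apply (prepend_row_series f1 (lam1 a) x y Hs1 Hx Hy).
    + apply is_Cseries_scal; apply (array_gf_series f0 x y Hs0 Hx Hy).
  - intros n; cbn beta.
    rewrite Cmult_assoc, row_balance_Setup by exact Hy; ring. }
unfold D.
transitivity ((lam1 a + tau a) * array_gf f1 x y - x * (lam1 a * array_gf f1 x y)); [ring|].
rewrite E; ring.
Qed.

(** The balance equations are multiplied by [x * y] to clear the denominators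
    that services introduce.  The breakdown and repair terms
    [gam * P - tau * P_setup] equal [lam1 * (1 - x) * P_setup] by the setup
    balance, which puts the left side in a form divisible by [1 - x]. *)
Lemma gf_balance_Operating (x y : C) :
  (Cmod x <= 1)%R -> (Cmod y <= 1)%R ->
  x * y * (1 - x) * (lam0 a * array_gf f0 x y + lam1 a * array_gf f1 x y)
  = y * (y - x) * serv1_gf a p f0 x y + x * (1 - y) * serv2_gf a p f0 x y.
Proof.
intros Hx Hy.
assert (E : x * (y * ((lam0 a + gam a) * array_gf f0 x y + serv1_gf a p f0 x y
                      + serv2_gf a p f0 x y)
                 - y * (x * (lam0 a * array_gf f0 x y) + tau a * array_gf f1 x y)
                 - serv2_gf a p f0 x y)
            = y * y * serv1_gf a p f0 x y).
(* row [n] receives the services of row [n + 1], and row 0 has none *)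
{ transitivity (y * y * (serv1_gf a p f0 x y - serv1_row a p f0 0 y * x ^ 0));
    [|unfold serv1_row; ring].
  eapply is_Cseries_eq; cycle 1.
  - apply is_Cseries_scal.
    apply is_Cseries_plus; [apply is_Cseries_plus|].
    + apply is_Cseries_scal; apply is_Cseries_plus; [apply is_Cseries_plus|].
      * apply is_Cseries_scal; apply (array_gf_series f0 x y Hs0 Hx Hy).
      * apply (serv1_gf_series a p f0 x y Hs0 Hx Hy).
      * apply (serv2_gf_series a p f0 x y Hs0 Hx Hy).
    + match goal with |- is_Cseries _ (- (y * ?z)) =>
        replace (- (y * z)) with (- y * z) by ring end.
      apply is_Cseries_scal; apply is_Cseries_plus.
      * apply (prepend_row_series f0 (lam0 a) x y Hs0 Hx Hy).
      * apply is_Cseries_scal; apply (array_gf_series f1 x y Hs1 Hx Hy).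
    + replace (- serv2_gf a p f0 x y) with (- RtoC 1 * serv2_gf a p f0 x y) by ring.
      apply is_Cseries_scal, (serv2_gf_series a p f0 x y Hs0 Hx Hy).
  - apply is_Cseries_scal.
    apply is_Cseries_shift with (u := fun n => serv1_row a p f0 n y * x ^ n).
    apply (serv1_gf_series a p f0 x y Hs0 Hx Hy).
  - intros n; cbn beta; rewrite Cpow_S.
    transitivity (x * x ^ n *
      (y * ((lam0 a + gam a) * row_gf f0 n y + serv1_row a p f0 n y + serv2_row a p f0 n y)
       - y * (prepend (RtoC 0) (fun m => lam0 a * row_gf f0 m y) n + tau a * row_gf f1 n y)
       - serv2_row a p f0 n y)); [ring|].
    rewrite row_balance_Operating by exact Hy; ring. }
assert (E1 := gf_balance_Setup x y Hx Hy); unfold D in E1.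
transitivity (x * (y * ((lam0 a + gam a) * array_gf f0 x y + serv1_gf a p f0 x y
                      + serv2_gf a p f0 x y)
                 - y * (x * (lam0 a * array_gf f0 x y) + tau a * array_gf f1 x y)
                 - serv2_gf a p f0 x y)
   + x * y * ((lam1 a * (1 - x) + tau a) * array_gf f1 x y - gam a * array_gf f0 x y)
   - x * y * serv1_gf a p f0 x y + x * (1 - y) * serv2_gf a p f0 x y); [ring|].
rewrite E, E1; ring.
Qed.

(** Eliminates the setup generating function from [gf_balance_Operating] after
    multiplication by [D]. *)
Lemma functional_equation (x y : C) :
  (Cmod x <= 1)%R -> (Cmod y <= 1)%R ->
  x * G a x y * array_gf f0 x y
  = D a x * ((nu2 a * x * (y - 1) - nu1 a * y * (x - y)) * load1 p f0 x y
             + nu1 a * y * (x - y) * array_gf f0 0 0).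
Proof.
intros Hx Hy.
assert (E0 := gf_balance_Operating x y Hx Hy); assert (E1 := gf_balance_Setup x y Hx Hy).
unfold serv1_gf, serv2_gf in E0; unfold G.
transitivity (D a x * (x * y * (1 - x)
    * (lam0 a * array_gf f0 x y + lam1 a * array_gf f1 x y))
  - x * y * (1 - x) * lam1 a * (D a x * array_gf f1 x y - gam a * array_gf f0 x y)
  - D a x * (nu2 a * x * (1 - y)) * array_gf f0 x y); [ring|].
rewrite E0, E1; ring.
Qed.

End Stationary.

(** * Dominated convergence *)

Open Scope R_scope.

Lemma is_lim_seq_sum_f_R0_zero (e : nat -> nat -> R) (N : nat) :
  (forall n, is_lim_seq (fun j => e j n) 0) ->
  is_lim_seq (fun j => sum_f_R0 (e j) N) 0.
Proof.
intros H; induction N as [|N IH]; simpl; [apply H|].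
replace 0 with (0 + 0) by ring; now apply is_lim_seq_plus'.
Qed.

(** A dominated double-indexed family is split at an index beyond which the
    dominating series has a small tail; the finitely many remaining terms vanish
    in the limit. *)
Lemma Series_vanish (e : nat -> nat -> R) (c : nat -> R) :
  (forall j n, 0 <= e j n <= c n) -> ex_series c ->
  (forall n, is_lim_seq (fun j => e j n) 0) ->
  is_lim_seq (fun j => Series (e j)) 0.
Proof.
intros He Hc Hl; apply is_lim_seq_spec; intros eps; simpl.
assert (Hex : forall j, ex_series (e j)).
{ intros j; apply (ex_series_le (V := R_CompleteNormedModule) (e j) c); [|exact Hc].
  intros n; change (Rabs (e j n) <= c n); rewrite Rabs_pos_eq; apply He. }
assert (T := Series_correct _ Hc : is_lim_seq (sum_n c) (Series c)).
apply is_lim_seq_spec in T; destruct (T (pos_div_2 eps)) as [N HN].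
specialize (HN N (le_n N)); simpl in HN.
rewrite sum_n_Reals, Rabs_minus_sym in HN.
rewrite (Series_incr_n c (S N)) in HN by (trivial; lia); simpl Init.Nat.pred in HN.
assert (F := is_lim_seq_sum_f_R0_zero e N Hl).
apply is_lim_seq_spec in F; destruct (F (pos_div_2 eps)) as [J HJ]; exists J.
intros j Hj; specialize (HJ j Hj); simpl in HJ.
rewrite (Series_incr_n (e j) (S N)) by (trivial; lia); simpl Init.Nat.pred.
assert (Tail : 0 <= Series (fun k => e j (S N + k)%nat) <= Series (fun k => c (S N + k)%nat)).
{ assert (X : ex_series (fun k => c (S N + k)%nat)) by now apply (ex_series_incr_n c).
  split; [|apply Series_le; [intros; apply He | exact X]].
  rewrite <- (is_series_unique _ _ is_series_zero_R).
  apply Series_le; [intros k; split; [lra|apply He]|].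
  now apply (ex_series_incr_n (e j)). }
apply Rabs_def2 in HN; apply Rabs_def2 in HJ; apply Rabs_def1; lra.
Qed.

(** Dominated convergence for series (Tannery). *)
Lemma is_lim_seq_Series (u : nat -> nat -> R) (v b : nat -> R) :
  (forall j n, Rabs (u j n) <= b n) -> ex_series b ->
  (forall n, is_lim_seq (fun j => u j n) (v n)) ->
  is_lim_seq (fun j => Series (u j)) (Series v).
Proof.
intros Hu Hb Hl.
assert (Hv : forall n, Rabs (v n) <= b n).
{ intros n.
  apply (is_lim_seq_le (fun j => Rabs (u j n)) (fun _ => b n) (Rabs (v n)) (b n)).
  - intros j; apply Hu.
  - exact (is_lim_seq_abs _ _ (Hl n)).
  - apply is_lim_seq_const. }
assert (Ex : forall w : nat -> R, (forall n, Rabs (w n) <= b n) -> ex_series w).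
{ intros w Hw; exact (ex_series_le (V := R_CompleteNormedModule) w b Hw Hb). }
assert (Z : is_lim_seq (fun j => Series (u j) - Series v) 0).
{ apply is_lim_seq_abs_0.
  apply (is_lim_seq_le_le (fun _ => 0) _ (fun j => Series (fun n => Rabs (u j n - v n)))).
  - intros j; split; [apply Rabs_pos|].
    rewrite <- Series_minus by (apply Ex; auto).
    apply Series_Rabs.
    apply (ex_series_le (V := R_CompleteNormedModule) _ (fun n => b n + b n)).
    + intros n; change (Rabs (Rabs (u j n - v n)) <= b n + b n).
      rewrite Rabs_Rabsolu; unfold Rminus; eapply Rle_trans; [apply Rabs_triang|].
      rewrite Rabs_Ropp; specialize (Hu j n); specialize (Hv n); lra.
    + exact (ex_series_plus (V := R_NormedModule) b b Hb Hb).
  - apply is_lim_seq_const.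
  - apply Series_vanish with (fun n => b n + b n).
    + intros j n; split; [apply Rabs_pos|].
      unfold Rminus; eapply Rle_trans; [apply Rabs_triang|].
      rewrite Rabs_Ropp; specialize (Hu j n); specialize (Hv n); lra.
    + exact (ex_series_plus (V := R_NormedModule) b b Hb Hb).
    + intros n; apply -> is_lim_seq_abs_0.
      replace 0 with (v n - v n) by ring.
      apply is_lim_seq_minus'; [apply Hl | apply is_lim_seq_const]. }
apply is_lim_seq_ext with (fun j => Series (u j) - Series v + Series v).
  intros j; ring.
replace (Finite (Series v)) with (Finite (0 + Series v)) by (f_equal; ring).
apply is_lim_seq_plus'; [exact Z | apply is_lim_seq_const].
Qed.

(** * Generating functions at real arguments *)

(** Continuity up to the boundary point is needed only along the real segment,
    where limits of real sequences suffice. *)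
Definition real_gf (f : nat -> nat -> R) (x y : R) : R :=
  Series (fun n => Series (fun k => f n k * x ^ n * y ^ k)).

Lemma array_gf_RtoC (f : nat -> nat -> R) (x y : R) :
  array_gf f (RtoC x) (RtoC y) = RtoC (real_gf f x y).
Proof.
assert (E : forall n k, (RtoC (f n k) * RtoC x ^ n * RtoC y ^ k)%C
                        = RtoC (f n k * x ^ n * y ^ k)).
{ intros n k; rewrite !RtoC_mult, !RtoC_pow; reflexivity. }
assert (Z : Series (fun _ => 0) = 0) by apply is_series_unique, is_series_zero_R.
apply injective_projections.
- apply Series_ext; intros n; apply Series_ext; intros k; now rewrite E.
- transitivity (Series (fun _ => 0)); [|exact Z].
  apply Series_ext; intros n; transitivity (Series (fun _ => 0)); [|exact Z].
  apply Series_ext; intros k; now rewrite E.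
Qed.

Lemma is_lim_seq_pow_n (u : nat -> R) (l : R) (n : nat) :
  is_lim_seq u l -> is_lim_seq (fun j => u j ^ n) (l ^ n).
Proof.
intros H; induction n as [|n IH]; simpl; [apply is_lim_seq_const|].
now apply is_lim_seq_mult'.
Qed.

Lemma real_gf_continuous (f : nat -> nat -> R) (xs ys : nat -> R) (x y : R) :
  summable_array f ->
  (forall j, Rabs (xs j) <= 1) -> (forall j, Rabs (ys j) <= 1) ->
  is_lim_seq xs x -> is_lim_seq ys y ->
  is_lim_seq (fun j => real_gf f (xs j) (ys j)) (real_gf f x y).
Proof.
intros [Hf [r [Hr Hr']]] Hxs Hys Hx Hy.
assert (B : forall j n k, Rabs (f n k * xs j ^ n * ys j ^ k) <= f n k).
{ intros j n k; rewrite !Rabs_mult, <- !RPow_abs, (Rabs_pos_eq (f n k)) by apply Hf.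
  assert (P : forall z m, Rabs z <= 1 -> 0 <= Rabs z ^ m <= 1).
  { intros z m Hz; split; [apply pow_le, Rabs_pos|].
    rewrite <- (pow1 m); apply pow_incr; split; [apply Rabs_pos | exact Hz]. }
  pose proof (P _ n (Hxs j)); pose proof (P _ k (Hys j)); pose proof (Hf n k).
  assert (Rabs (xs j) ^ n * Rabs (ys j) ^ k <= 1) by nra; nra. }
apply is_lim_seq_Series with r; [|exact Hr'|].
- intros j n; eapply Rle_trans; [apply Series_Rabs|].
  + apply (ex_series_le (V := R_CompleteNormedModule) _ (f n)); [|eexists; apply Hr].
    intros k; change (Rabs (Rabs (f n k * xs j ^ n * ys j ^ k)) <= f n k).
    rewrite Rabs_Rabsolu; apply B.
  + rewrite <- (is_series_unique _ _ (Hr n)); apply Series_le; [|eexists; apply Hr].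
    intros k; split; [apply Rabs_pos | apply B].
- intros n; apply is_lim_seq_Series with (f n); [|eexists; apply Hr|].
  + intros j k; apply B.
  + intros k; apply is_lim_seq_mult'; [apply is_lim_seq_mult'|].
    * apply is_lim_seq_const.
    * apply is_lim_seq_pow_n, Hx.
    * apply is_lim_seq_pow_n, Hy.
Qed.

Lemma is_lim_seq_inv_INR (d : R) : is_lim_seq (fun j => d * / (INR j + 1)) 0.
Proof.
replace (Finite 0) with (Finite (d * 0)) by (f_equal; ring).
apply is_lim_seq_mult'; [apply is_lim_seq_const|].
apply is_lim_seq_inv with (l := p_infty); [|discriminate].
apply is_lim_seq_plus with (l1 := p_infty) (l2 := Finite 1);
  [apply is_lim_seq_INR | apply is_lim_seq_const | reflexivity].
Qed.

Lemma inv_INR_bounds (j : nat) : 0 < / (INR j + 1) <= 1.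
Proof.
pose proof (pos_INR j); split; [apply Rinv_0_lt_compat; lra|].
rewrite <- Rinv_1; apply Rinv_le_contravar; lra.
Qed.

(** * Flow balance at the two stations *)

Open Scope R_scope.

Lemma real_gf_mass (mu : state -> R) (q : state -> state -> R) :
  is_stationary q mu ->
  real_gf (mode_array mu Operating) 1 1 + real_gf (mode_array mu Setup) 1 1 = 1.
Proof.
intros H.
destruct (stationary_summable _ _ Operating H) as [_ [r0 [Hr0 Es0]]].
destruct (stationary_summable _ _ Setup H) as [_ [r1 [Hr1 Es1]]].
assert (E : forall f r, (forall n, is_series (f n) (r n)) -> real_gf f 1 1 = Series r).
{ intros f r Hr; apply Series_ext; intros n; rewrite <- (is_series_unique _ _ (Hr n)).
  apply Series_ext; intros k; rewrite !pow1; ring. }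
rewrite (E _ _ Hr0), (E _ _ Hr1), <- Series_plus by assumption.
destruct (stat_mass _ _ H) as [r [Hr Hs]].
apply is_series_unique; apply is_series_ext with (2 := Hs); intros n.
rewrite <- (is_series_unique _ _ (Hr Operating n)), <- (is_series_unique _ _ (Hr Setup n)).
rewrite <- (is_series_unique _ _ (Hr0 n)), <- (is_series_unique _ _ (Hr1 n)).
reflexivity.
Qed.

(** A sequence in the open unit interval tending to [1]. *)
Definition approach1 (j : nat) : R := 1 - / 2 * / (INR j + 1).

Lemma approach1_bounds (j : nat) : 0 < approach1 j < 1.
Proof. unfold approach1; pose proof (inv_INR_bounds j); lra. Qed.

Lemma is_lim_seq_approach1 : is_lim_seq approach1 1.
Proof.
replace (Finite 1) with (Finite (1 - 0)) by (f_equal; ring).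
apply is_lim_seq_minus'; [apply is_lim_seq_const | apply is_lim_seq_inv_INR].
Qed.

Section Loads.
Variables (a : params) (p : R) (mu : state -> R).
Hypothesis Hst : is_stationary (rate a p) mu.
Hypotheses (nu1_pos : 0 < nu1 a) (nu2_pos : 0 < nu2 a)
  (gam_pos : 0 < gam a) (tau_pos : 0 < tau a).

Let f0 := mode_array mu Operating.
Let f1 := mode_array mu Setup.

Definition real_load1 (f : nat -> nat -> R) (x y : R) : R :=
  real_gf f x 0 + p * (real_gf f x y - real_gf f x 0 - real_gf f 0 y + real_gf f 0 0).

Lemma load1_RtoC (f : nat -> nat -> R) (x y : R) :
  load1 p f (RtoC x) (RtoC y) = RtoC (real_load1 f x y).
Proof.
unfold load1, interior_gf; rewrite !array_gf_RtoC.
unfold real_load1; rewrite !RtoC_plus, !RtoC_mult, RtoC_plus, !RtoC_minus; reflexivity.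
Qed.

Lemma Cmod_RtoC_le_1 (x : R) : 0 <= x <= 1 -> Cmod (RtoC x) <= 1.
Proof. intros H; rewrite Cmod_R, Rabs_pos_eq; lra. Qed.

Lemma real_balance_Setup (x y : R) :
  0 <= x <= 1 -> 0 <= y <= 1 ->
  (lam1 a * (1 - x) + tau a) * real_gf f1 x y = gam a * real_gf f0 x y.
Proof.
intros Hx Hy; apply RtoC_inj.
assert (E := gf_balance_Setup a p mu Hst x y (Cmod_RtoC_le_1 _ Hx) (Cmod_RtoC_le_1 _ Hy)).
rewrite !array_gf_RtoC in E; unfold D in E; fold f0 f1 in E.
rewrite !RtoC_mult, RtoC_plus, RtoC_mult, RtoC_minus; exact E.
Qed.

Lemma real_balance_Operating (x y : R) :
  0 <= x <= 1 -> 0 <= y <= 1 ->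
  x * y * (1 - x) * (lam0 a * real_gf f0 x y + lam1 a * real_gf f1 x y)
  = y * (y - x) * (nu1 a * (real_load1 f0 x y - real_gf f0 0 0))
    + x * (1 - y) * (nu2 a * (real_gf f0 x y - real_load1 f0 x y)).
Proof.
intros Hx Hy; apply RtoC_inj.
assert (E := gf_balance_Operating a p mu Hst x y (Cmod_RtoC_le_1 _ Hx) (Cmod_RtoC_le_1 _ Hy)).
unfold serv1_gf, serv2_gf in E; rewrite load1_RtoC, !array_gf_RtoC in E; fold f0 f1 in E.
repeat (rewrite RtoC_plus || rewrite RtoC_mult || rewrite RtoC_minus); exact E.
Qed.

Lemma real_load1_continuous (xs ys : nat -> R) (x y : R) :
  (forall j, Rabs (xs j) <= 1) -> (forall j, Rabs (ys j) <= 1) ->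
  is_lim_seq xs x -> is_lim_seq ys y ->
  is_lim_seq (fun j => real_load1 f0 (xs j) (ys j)) (real_load1 f0 x y).
Proof.
intros Bx By Hx Hy.
assert (Hs := stationary_summable _ _ Operating Hst).
assert (B0 : forall j : nat, Rabs ((fun _ => 0) j) <= 1) by (intros j; rewrite Rabs_R0; lra).
assert (L0 := is_lim_seq_const 0).
unfold real_load1; apply is_lim_seq_plus'.
  apply (real_gf_continuous f0 xs _ x 0 Hs Bx B0 Hx L0).
apply is_lim_seq_mult'; [apply is_lim_seq_const|].
apply is_lim_seq_plus'; [apply is_lim_seq_minus'; [apply is_lim_seq_minus'|]|].
- apply (real_gf_continuous f0 xs ys x y Hs Bx By Hx Hy).
- apply (real_gf_continuous f0 xs _ x 0 Hs Bx B0 Hx L0).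
- apply (real_gf_continuous f0 _ ys 0 y Hs B0 By L0 Hy).
- apply is_lim_seq_const.
Qed.

Lemma is_lim_seq_unique_eq (u v : nat -> R) (k l : R) :
  (forall j, u j = v j) -> is_lim_seq u k -> is_lim_seq v l -> k = l.
Proof.
intros E Hu Hv; apply is_lim_seq_ext with (1 := E) in Hu.
apply is_lim_seq_unique in Hu; apply is_lim_seq_unique in Hv; congruence.
Qed.

Lemma approach1_abs (j : nat) : Rabs (approach1 j) <= 1.
Proof. pose proof (approach1_bounds j); rewrite Rabs_pos_eq; lra. Qed.

(** Arrivals to station 1 balance its departures: the operating balance on
    [y = 1] divided by [1 - x], in the limit [x -> 1].  No moment of the queue
    lengths is needed, since the division happens before the limit. *)
Lemma station1_flow :
  lam0 a * real_gf f0 1 1 + lam1 a * real_gf f1 1 1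
  = nu1 a * (real_load1 f0 1 1 - real_gf f0 0 0).
Proof.
assert (B1 : forall j : nat, Rabs ((fun _ => 1) j) <= 1) by (intros j; rewrite Rabs_R1; lra).
assert (L := is_lim_seq_approach1); assert (L1 := is_lim_seq_const 1).
apply is_lim_seq_unique_eq with
  (u := fun j => approach1 j * (lam0 a * real_gf f0 (approach1 j) 1
                                + lam1 a * real_gf f1 (approach1 j) 1))
  (v := fun j => nu1 a * (real_load1 f0 (approach1 j) 1 - real_gf f0 0 0)).
- intros j; pose proof (approach1_bounds j).
  assert (E := real_balance_Operating (approach1 j) 1 ltac:(lra) ltac:(lra)).
  apply Rmult_eq_reg_l with (1 - approach1 j); [|lra].
  transitivity (approach1 j * 1 * (1 - approach1 j)
    * (lam0 a * real_gf f0 (approach1 j) 1 + lam1 a * real_gf f1 (approach1 j) 1)); [ring|].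
  rewrite E; ring.
- rewrite <- (Rmult_1_l (_ + _)).
  apply is_lim_seq_mult'; [exact L|]; apply is_lim_seq_plus';
    (apply is_lim_seq_mult'; [apply is_lim_seq_const|]).
  + apply (real_gf_continuous f0 _ _ 1 1 (stationary_summable _ _ _ Hst) approach1_abs B1 L L1).
  + apply (real_gf_continuous f1 _ _ 1 1 (stationary_summable _ _ _ Hst) approach1_abs B1 L L1).
- apply is_lim_seq_mult'; [apply is_lim_seq_const|].
  apply is_lim_seq_minus'; [|apply is_lim_seq_const].
  apply (real_load1_continuous _ _ 1 1 approach1_abs B1 L L1).
Qed.

(** Station 2 is fed by the departures of station 1: the operating balance on
    [x = 1] divided by [1 - y], in the limit [y -> 1]. *)
Lemma station2_flow :
  nu1 a * (real_load1 f0 1 1 - real_gf f0 0 0)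
  = nu2 a * (real_gf f0 1 1 - real_load1 f0 1 1).
Proof.
assert (B1 : forall j : nat, Rabs ((fun _ => 1) j) <= 1) by (intros j; rewrite Rabs_R1; lra).
assert (L := is_lim_seq_approach1); assert (L1 := is_lim_seq_const 1).
apply is_lim_seq_unique_eq with
  (u := fun j => approach1 j * (nu1 a * (real_load1 f0 1 (approach1 j) - real_gf f0 0 0)))
  (v := fun j => nu2 a * (real_gf f0 1 (approach1 j) - real_load1 f0 1 (approach1 j))).
- intros j; pose proof (approach1_bounds j).
  assert (E := real_balance_Operating 1 (approach1 j) ltac:(lra) ltac:(lra)).
  apply Rmult_eq_reg_l with (1 - approach1 j); [|lra].
  apply Rminus_diag_uniq.
  transitivity (1 * approach1 j * (1 - 1)
      * (lam0 a * real_gf f0 1 (approach1 j) + lam1 a * real_gf f1 1 (approach1 j))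
    - (1 * approach1 j * (1 - 1)
      * (lam0 a * real_gf f0 1 (approach1 j) + lam1 a * real_gf f1 1 (approach1 j))));
    [rewrite E at 2|]; ring.
- rewrite <- (Rmult_1_l (_ * _)).
  apply is_lim_seq_mult'; [exact L|].
  apply is_lim_seq_mult'; [apply is_lim_seq_const|].
  apply is_lim_seq_minus'; [|apply is_lim_seq_const].
  apply (real_load1_continuous _ _ 1 1 B1 approach1_abs L1 L).
- apply is_lim_seq_mult'; [apply is_lim_seq_const|].
  apply is_lim_seq_minus'.
  + apply (real_gf_continuous f0 _ _ 1 1 (stationary_summable _ _ _ Hst) B1 approach1_abs L1 L).
  + apply (real_load1_continuous _ _ 1 1 B1 approach1_abs L1 L).
Qed.

(** Long-run fraction of time in operating mode: the mode is a two-state chain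
    that ignores the queues. *)
Definition up_time : R := tau a / (tau a + gam a).
Definition throughput : R := lam0 a * up_time + lam1 a * (1 - up_time).

Lemma real_gf_up_time : real_gf f0 1 1 = up_time /\ real_gf f1 1 1 = 1 - up_time.
Proof.
assert (M := real_gf_mass mu _ Hst); fold f0 f1 in M.
assert (E := real_balance_Setup 1 1 ltac:(lra) ltac:(lra)).
assert (T : real_gf f0 1 1 = up_time); [|split; lra].
unfold up_time; apply Rmult_eq_reg_r with (tau a + gam a); [|lra].
field_simplify; [|lra]; nra.
Qed.

(** The two flow balances and the known probability of the operating mode
    determine both the load and the idle probability, and none of these data
    involves [p]. *)
Lemma load1_at_1 : load1 p f0 1 1 = RtoC (up_time - throughput / nu2 a).
Proof.
rewrite load1_RtoC; f_equal.
assert (E1 := station1_flow); assert (E2 := station2_flow).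
destruct real_gf_up_time as [U0 U1]; rewrite U0, U1 in E1; rewrite U0 in E2.
fold throughput in E1; rewrite <- E1 in E2.
apply Rmult_eq_reg_l with (nu2 a); [|lra].
field_simplify; [|lra]; lra.
Qed.

(** Each job needs [1 / nu1 + 1 / nu2] units of full capacity however the
    capacity is shared, so the idle fraction does not involve [p]. *)
Lemma idle_probability :
  array_gf f0 0 0 = RtoC (up_time - throughput / nu2 a - throughput / nu1 a).
Proof.
assert (E := load1_at_1); rewrite load1_RtoC in E; apply RtoC_inj in E.
rewrite array_gf_RtoC; f_equal.
rewrite <- E; assert (E1 := station1_flow).
destruct real_gf_up_time as [U0 U1]; rewrite U0, U1 in E1; fold throughput in E1.
rewrite E1; field; lra.
Qed.

End Loads.

(** * Zeros of the kernel in the closed unit disc *)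

Open Scope R_scope.
Open Scope C_scope.

Lemma Cmod_ge_Re (z : C) (r : R) : (0 <= r)%R -> (r <= Re z)%R -> (r <= Cmod z)%R.
Proof.
intros Hr H; apply Rle_trans with (1 := H).
apply Rle_trans with (2 := re_le_Cmod z), Rle_abs.
Qed.

Lemma Cmod_pos_neq_0 (z : C) (r : R) : (0 < r)%R -> (r <= Cmod z)%R -> z <> 0.
Proof. intros Hr H E; rewrite E, Cmod_0 in H; lra. Qed.

Lemma Re_1_minus_nonneg (x : C) : (Cmod x <= 1)%R -> (0 <= Re (1 - x))%R.
Proof.
intros H; pose proof (re_le_Cmod x); pose proof (Rle_abs (Re x)).
change (0 <= 1 + - Re x)%R; lra.
Qed.

(** The number of arrivals during an operating time [s], counting those of the
    interrupting setup periods, has generating function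
    [exp (- s * arrival_exponent a x)].  Hence [nu / (nu + arrival_exponent a x)]
    is the generating function of the arrivals during a service of rate [nu]. *)
Definition arrival_exponent (a : params) (x : C) : C :=
  lam0 a * (1 - x) + lam1 a * gam a * ((1 - x) / D a x).

Section Kernel.
Variable a : params.
Hypotheses (lam0_pos : (0 < lam0 a)%R) (lam1_pos : (0 < lam1 a)%R)
  (nu1_pos : (0 < nu1 a)%R) (nu2_pos : (0 < nu2 a)%R)
  (gam_pos : (0 < gam a)%R) (tau_pos : (0 < tau a)%R).
Variable x : C.
Hypothesis Hx : (Cmod x <= 1)%R.

Lemma Cmod_D_ge : (tau a <= Cmod (D a x))%R.
Proof.
apply Cmod_ge_Re; [lra|].
pose proof (Re_1_minus_nonneg x Hx).
unfold D; change (tau a <= Re (lam1 a * (1 - x)) + tau a)%R.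
rewrite re_scal_l; nra.
Qed.

Lemma D_neq_0 : D a x <> 0.
Proof. exact (Cmod_pos_neq_0 _ _ tau_pos Cmod_D_ge). Qed.

(** For [Re z >= 0] the number [z / (lam1 * z + tau)] has nonnegative real part:
    multiplied by the squared modulus of its denominator it is
    [lam1 * |z|^2 + tau * z]. *)
Lemma Re_arrival_exponent_nonneg : (0 <= Re (arrival_exponent a x))%R.
Proof.
pose proof (Re_1_minus_nonneg x Hx) as H.
assert (H2 : (0 <= Re ((1 - x) / D a x))%R).
{ unfold D; destruct (1 - x) as [u v]; simpl in *.
  match goal with |- (0 <= u * (?A / ?B) - v * (- ?C / ?B))%R =>
    replace (u * (A / B) - v * (- C / B))%R with ((u * A + v * C) * / B)%R
      by (unfold Rdiv; ring);
    assert (HA : (0 < A)%R) by nra;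
    assert (HB : (0 < B)%R) by
      (pose proof (Rmult_lt_0_compat A A HA HA); pose proof (Rle_0_sqr C);
       unfold Rsqr in *; lra);
    apply Rmult_le_pos; [|left; now apply Rinv_0_lt_compat];
    replace (u * A + v * C)%R with (u * A + lam1 a * (v * v))%R by ring end.
  apply Rplus_le_le_0_compat; apply Rmult_le_pos; nra. }
unfold arrival_exponent.
change (0 <= Re (lam0 a * (1 - x)) + Re (lam1 a * gam a * ((1 - x) / D a x)))%R.
rewrite <- RtoC_mult, !re_scal_l.
apply Rplus_le_le_0_compat; apply Rmult_le_pos; nra.
Qed.

Lemma Cmod_plus_arrival_exponent_ge (nu : R) :
  (0 < nu)%R -> (nu <= Cmod (nu + arrival_exponent a x))%R.
Proof.
intros Hn; apply Cmod_ge_Re; [lra|].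
pose proof Re_arrival_exponent_nonneg; change (nu <= nu + Re (arrival_exponent a x))%R; lra.
Qed.

Lemma plus_arrival_exponent_neq_0 (nu : R) :
  (0 < nu)%R -> nu + arrival_exponent a x <> 0.
Proof. intros Hn; exact (Cmod_pos_neq_0 _ _ Hn (Cmod_plus_arrival_exponent_ge nu Hn)). Qed.

(** So [Ytilde] is the generating function of the arrivals during one service at
    station 2. *)
Lemma Ytilde_arrival_exponent : Ytilde a x = nu2 a / (nu2 a + arrival_exponent a x).
Proof.
assert (E : D a x * (nu2 a + lam0 a * (1 - x)) + lam1 a * gam a * (1 - x)
            = D a x * (nu2 a + arrival_exponent a x)).
{ unfold arrival_exponent; field; exact D_neq_0. }
unfold Ytilde; rewrite E; field.
split; [exact (plus_arrival_exponent_neq_0 _ nu2_pos) | exact D_neq_0].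
Qed.

Lemma Cmod_service_arrivals_le_1 (nu : R) :
  (0 < nu)%R -> (Cmod (nu / (nu + arrival_exponent a x)) <= 1)%R.
Proof.
intros Hn; pose proof (Cmod_plus_arrival_exponent_ge nu Hn).
rewrite Cmod_div by (now apply plus_arrival_exponent_neq_0).
rewrite Cmod_R, Rabs_pos_eq by lra.
apply -> Rdiv_le_1; lra.
Qed.

Lemma Cmod_Ytilde_le_1 : (Cmod (Ytilde a x) <= 1)%R.
Proof. rewrite Ytilde_arrival_exponent; exact (Cmod_service_arrivals_le_1 _ nu2_pos). Qed.

Lemma G_arrival_exponent (y : C) :
  G a x y = D a x * (y * (nu2 a + arrival_exponent a x) - nu2 a).
Proof. unfold G, arrival_exponent; field; exact D_neq_0. Qed.

Lemma G_Ytilde : G a x (Ytilde a x) = 0.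
Proof.
rewrite G_arrival_exponent, Ytilde_arrival_exponent; field; exact (plus_arrival_exponent_neq_0 _ nu2_pos).
Qed.

Hypothesis stability :
  (lam0 a * (1 / nu1 a + 1 / nu2 a) * (tau a / (tau a + gam a))
   + lam1 a * (1 / nu1 a + 1 / nu2 a) * (gam a / (tau a + gam a))
   < tau a / (tau a + gam a))%R.

(** The mean number of arrivals during the total service of one job is less than
    one. *)
Lemma stability_contraction :
  ((lam0 a + lam1 a * gam a / tau a) * (/ nu1 a + / nu2 a) < 1)%R.
Proof.
apply Rmult_lt_reg_r with (tau a / (tau a + gam a))%R.
- apply Rdiv_lt_0_compat; lra.
- rewrite Rmult_1_l; apply Rle_lt_trans with (2 := stability).
  right; field; lra.
Qed.

(** The bound uses [|D| >= tau] on the closed unit disc. *)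
Lemma Cmod_arrival_exponent_le :
  (Cmod (arrival_exponent a x) <= (lam0 a + lam1 a * gam a / tau a) * Cmod (1 - x))%R.
Proof.
unfold arrival_exponent; eapply Rle_trans; [apply Cmod_triangle|].
pose proof Cmod_D_ge; pose proof (Cmod_ge_0 (1 - x)).
rewrite !Cmod_mult, !Cmod_R, !Rabs_pos_eq, Cmod_div by (apply D_neq_0 || lra).
assert (Cmod (1 - x) / Cmod (D a x) <= Cmod (1 - x) / tau a)%R.
{ apply Rmult_le_compat_l; [lra|]; apply Rinv_le_contravar; lra. }
assert (lam1 a * gam a * (Cmod (1 - x) / Cmod (D a x))
        <= lam1 a * gam a * (Cmod (1 - x) / tau a))%R
  by (apply Rmult_le_compat_l; nra).
unfold Rdiv in *; lra.
Qed.

Lemma Cmod_1_minus_service_arrivals (nu : R) :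
  (0 < nu)%R -> (Cmod (1 - nu / (nu + arrival_exponent a x)) <= Cmod (arrival_exponent a x) * / nu)%R.
Proof.
intros Hn; pose proof (Cmod_plus_arrival_exponent_ge nu Hn).
replace (1 - nu / (nu + arrival_exponent a x)) with (arrival_exponent a x / (nu + arrival_exponent a x))
  by (field; now apply plus_arrival_exponent_neq_0).
rewrite Cmod_div by (now apply plus_arrival_exponent_neq_0).
apply Rmult_le_compat_l; [apply Cmod_ge_0|]; apply Rinv_le_contravar; lra.
Qed.

(** A zero is a fixed point [x = b1 * b2] of the generating function of the
    arrivals during the total service of one job.  On the closed unit disc this
    function shrinks the distance to [1] by a factor that stability makes less
    than one, so [1] is its only fixed point. *)
Lemma kernel_zero :
  nu2 a * x * (Ytilde a x - 1) - nu1 a * Ytilde a x * (x - Ytilde a x) = 0 -> x = 1.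
Proof.
intros E; assert (N1 := plus_arrival_exponent_neq_0 _ nu1_pos); assert (N2 := plus_arrival_exponent_neq_0 _ nu2_pos).
set (b1 := nu1 a / (nu1 a + arrival_exponent a x)).
set (b2 := nu2 a / (nu2 a + arrival_exponent a x)).
assert (Nu2 : RtoC (nu2 a) <> 0) by (intros Z; apply RtoC_inj in Z; lra).
assert (X : x = b1 * b2).
{ rewrite Ytilde_arrival_exponent in E; unfold b1, b2.
  (* with [e] the exponent, the kernel is [b1 * b2 - x] times
     [nu2 * (nu1 + e) / (nu2 + e)] *)
  transitivity (x + (nu2 a * x * (nu2 a / (nu2 a + arrival_exponent a x) - 1)
      - nu1 a * (nu2 a / (nu2 a + arrival_exponent a x)) * (x - nu2 a / (nu2 a + arrival_exponent a x)))
      * ((nu2 a + arrival_exponent a x) / (nu2 a * (nu1 a + arrival_exponent a x)))).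
  - rewrite E; ring.
  - field; auto. }
destruct (Ceq_dec x 1) as [|Nx]; [assumption|exfalso].
assert (P : (0 < Cmod (1 - x))%R).
{ apply Cmod_gt_0; intros Z; apply Nx; replace x with (1 - (1 - x)) by ring; rewrite Z; ring. }
assert (B : (Cmod (1 - x) <= Cmod (arrival_exponent a x) * (/ nu1 a + / nu2 a))%R).
{ rewrite X at 1; replace (1 - b1 * b2) with ((1 - b1) + b1 * (1 - b2)) by ring.
  eapply Rle_trans; [apply Cmod_triangle|]; rewrite Cmod_mult.
  pose proof (Cmod_1_minus_service_arrivals _ nu1_pos) as H1; fold b1 in H1.
  pose proof (Cmod_1_minus_service_arrivals _ nu2_pos) as H2; fold b2 in H2.
  pose proof (Cmod_service_arrivals_le_1 _ nu1_pos) as H3; fold b1 in H3.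
  pose proof (Cmod_ge_0 (1 - b2)); pose proof (Cmod_ge_0 b1); nra. }
pose proof Cmod_arrival_exponent_le as H; pose proof stability_contraction as S.
assert (I : (0 < / nu1 a + / nu2 a)%R)
  by (apply Rplus_lt_0_compat; now apply Rinv_0_lt_compat).
apply Rmult_le_compat_r with (r := (/ nu1 a + / nu2 a)%R) in H; [|lra].
nra.
Qed.

End Kernel.

(** * Expansions at zero along the unit interval *)

Open Scope R_scope.

(** The terms of a convergent series tend to zero, which they cannot do outside
    the disc of convergence. *)
Lemma CV_radius_pos (c : nat -> R) (r : R) :
  0 < r -> ex_series (fun n => c n * r ^ n) -> Rbar_lt 0 (CV_radius c).
Proof.
intros Hr H.
destruct (Rbar_lt_le_dec 0 (CV_radius c)) as [L|L]; [exact L|].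
exfalso; apply (CV_disk_outside c r); [|exact (ex_series_lim_0 _ H)].
apply Rbar_le_lt_trans with (1 := L); simpl; rewrite Rabs_pos_eq; lra.
Qed.

(** The power series is continuous at zero, so its constant term is the limit of
    the values at a sequence of positive points. *)
Lemma coef_0_zero (c : nat -> R) (eps : R) :
  0 < eps -> (forall r, 0 < r < eps -> is_series (fun n => c n * r ^ n) 0) ->
  c 0%nat = 0.
Proof.
intros He H.
assert (HR : Rbar_lt (Rabs 0) (CV_radius c)).
{ rewrite Rabs_R0; apply CV_radius_pos with (eps / 2); [lra|].
  exists 0; apply H; lra. }
assert (L := is_lim_seq_continuous (PSeries c) _ 0 (PSeries_continuity c 0 HR)
               (is_lim_seq_inv_INR (eps / 2))).
rewrite PSeries_0 in L.
assert (L0 : is_lim_seq (fun _ => 0) (c 0%nat)).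
{ apply is_lim_seq_ext with (2 := L); intros j; apply is_series_unique, H.
  pose proof (inv_INR_bounds j); split; [apply Rmult_lt_0_compat|]; nra. }
apply is_lim_seq_unique in L0; rewrite Lim_seq_const in L0; congruence.
Qed.

(** One-sided uniqueness: the constant term vanishes, divide by the variable and
    repeat. *)
Lemma coef_zero (c : nat -> R) (eps : R) (m : nat) :
  0 < eps -> (forall r, 0 < r < eps -> is_series (fun n => c n * r ^ n) 0) ->
  c m = 0.
Proof.
intros He; revert c; induction m as [|m IH]; intros c H; [now apply coef_0_zero with eps|].
apply (IH (fun n => c (S n))); intros r Hr.
assert (Z : is_series (fun n => c (S n) * r ^ S n) 0).
{ apply (is_series_incr_1 (V := R_NormedModule) (fun n => c n * r ^ n)).
  rewrite (coef_0_zero c eps He H), Rmult_0_l.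
  change (is_series (fun n => c n * r ^ n) (0 + 0)); rewrite Rplus_0_l; auto. }
apply (is_series_scal (V := R_NormedModule) (/ r)) in Z.
change (scal (/ r) 0) with (/ r * 0) in Z; rewrite Rmult_0_r in Z.
apply is_series_ext with (2 := Z); intros n.
change (/ r * (c (S n) * (r * r ^ n)) = c (S n) * r ^ n); field; lra.
Qed.

Open Scope C_scope.

Lemma is_pseries_Cseries (c : nat -> C) (z l : C) :
  is_pseries (K := C_AbsRing) (V := C_NormedModule) c z l <->
  is_Cseries (fun n => c n * z ^ n) l.
Proof.
assert (E : forall n, scal (K := C_AbsRing) (V := C_NormedModule)
                        (pow_n (K := C_AbsRing) z n) (c n) = c n * z ^ n).
{ intros n; apply Cmult_comm. }
split; apply is_series_ext; auto.
Qed.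

Lemma expands_at_0_zero (f : R -> C) (c : nat -> C) (m : nat) :
  (forall p, (0 <= p <= 1)%R -> f p = 0) -> expands_at_0 f c -> c m = 0.
Proof.
intros Hf [eps [He H]].
set (d := Rmin eps 1).
assert (Hd : (0 < d)%R) by (apply Rmin_pos; lra).
assert (H' : forall r, (0 < r < d)%R -> is_Cseries (fun n => c n * RtoC r ^ n) 0).
{ intros r Hr; pose proof (Rmin_l eps 1); pose proof (Rmin_r eps 1); unfold d in Hr.
  rewrite <- (Hf r) by lra; apply is_pseries_Cseries, H; lra. }
apply injective_projections.
- apply (coef_zero (fun n => Re (c n)) d m Hd); intros r Hr.
  apply is_series_ext with (2 := is_Cseries_Re _ _ (H' r Hr)).
  intros n; rewrite <- RtoC_pow; apply re_scal_r.
- apply (coef_zero (fun n => Im (c n)) d m Hd); intros r Hr.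
  apply is_series_ext with (2 := is_Cseries_Im _ _ (H' r Hr)).
  intros n; rewrite <- RtoC_pow; apply im_scal_r.
Qed.

Lemma expands_at_0_plus (f g : R -> C) (c d : nat -> C) :
  expands_at_0 f c -> expands_at_0 g d ->
  expands_at_0 (fun p => f p + g p) (fun m => c m + d m).
Proof.
intros [e1 [He1 H1]] [e2 [He2 H2]].
exists (Rmin e1 e2); split; [now apply Rmin_pos|].
intros p Hp Hpe.
pose proof (Rmin_l e1 e2); pose proof (Rmin_r e1 e2).
apply (is_pseries_plus (V := C_NormedModule)); [apply H1 | apply H2]; lra.
Qed.

Lemma expands_at_0_scal (b : C) (f : R -> C) (c : nat -> C) :
  expands_at_0 f c -> expands_at_0 (fun p => b * f p) (fun m => b * c m).
Proof.
intros [e [He H]]; exists e; split; [exact He|].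
intros p Hp Hpe; apply (is_pseries_scal (V := C_NormedModule)); [apply Cmult_comm|].
now apply H.
Qed.

Lemma expands_at_0_incr (f : R -> C) (c : nat -> C) :
  expands_at_0 f c ->
  expands_at_0 (fun p => RtoC p * f p) (fun m => match m with O => 0 | S l => c l end).
Proof.
intros [e [He H]]; exists e; split; [exact He|].
intros p Hp Hpe; apply is_pseries_Cseries.
specialize (H p Hp Hpe); apply is_pseries_Cseries in H.
now apply is_Cseries_pow_shift.
Qed.

Lemma expands_at_0_coef_0 (f : R -> C) (c : nat -> C) :
  expands_at_0 f c -> c 0%nat = f 0%R.
Proof.
intros [e [He H]].
specialize (H 0%R ltac:(lra) He); apply is_pseries_Cseries in H.
exact (is_Cseries_eq _ _ _ _ (fun n => eq_refl) (is_Cseries_at_0 c) H).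
Qed.

Lemma expands_at_0_const (b : C) :
  expands_at_0 (fun _ => b) (fun m => match m with O => b | S _ => 0 end).
Proof.
exists 1%R; split; [lra|]; intros p _ _; apply is_pseries_Cseries.
assert (H := is_Cseries_unshift
               (fun m => match m with O => b | S _ => 0 end * RtoC p ^ m) 0).
cbv beta iota in H; replace (b * RtoC p ^ 0 + 0) with b in H by (simpl; ring); apply H.
apply is_series_ext with (2 := is_Cseries_zero); intros n.
symmetry; apply Cmult_0_l.
Qed.

(** * Dependence on the coupling parameter *)

Open Scope R_scope.
Open Scope C_scope.

Lemma Cmult_reg_l (c z w : C) : c <> 0 -> c * z = c * w -> z = w.
Proof.
intros Hc E; replace z with (c * z / c) by (field; exact Hc).
rewrite E; field; exact Hc.
Qed.

Section Perturbation.
Variable a : params.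
Hypotheses (lam0_pos : (0 < lam0 a)%R) (lam1_pos : (0 < lam1 a)%R)
  (nu1_pos : (0 < nu1 a)%R) (nu2_pos : (0 < nu2 a)%R)
  (gam_pos : (0 < gam a)%R) (tau_pos : (0 < tau a)%R).

(** The functional equation on the curve [y = Ytilde x], where [G] vanishes. *)
Lemma kernel_equation (p : R) (mu : state -> R) (x : C) :
  is_stationary (rate a p) mu -> (Cmod x <= 1)%R ->
  (nu2 a * x * (Ytilde a x - 1) - nu1 a * Ytilde a x * (x - Ytilde a x))
    * load1 p (mode_array mu Operating) x (Ytilde a x)
  = - (nu1 a * Ytilde a x * (x - Ytilde a x)) * array_gf (mode_array mu Operating) 0 0.
Proof.
intros Hst Hx.
assert (E := functional_equation a p mu Hst x (Ytilde a x) Hx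
               ltac:(apply Cmod_Ytilde_le_1; assumption)).
rewrite G_Ytilde in E by assumption.
assert (ND : D a x <> 0) by (apply D_neq_0; assumption).
apply Cmult_reg_l with (1 := ND).
match type of E with ?l = D a x * (?k * ?t + ?m) =>
  transitivity (D a x * (k * t + m) - D a x * m); [ring|] end.
rewrite <- E; ring.
Qed.

(** Replaces the functional equation at [x = 0], where the latter reads [0 = 0].
    At [p = 0] station 1 serves only when station 2 is empty, so a single unknown
    of the next row enters. *)
Lemma idle_row_equation (mu : state -> R) (y : C) :
  is_stationary (rate a 0) mu -> (Cmod y <= 1)%R ->
  G a 0 y * array_gf (mode_array mu Operating) 0 y
  = D a 0 * (nu2 a * (y - 1) * array_gf (mode_array mu Operating) 0 0
             + nu1 a * y * y * mode_array mu Operating 1 0).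
Proof.
intros Hst Hy.
assert (Hs := stationary_summable _ _ Operating Hst).
rewrite !array_gf_0_l, row_gf_0 by (assumption || exact Cmod_0_le_1).
assert (E0 := row_balance_Operating a 0 mu Hst 0 y Hy).
assert (E1 := row_balance_Setup a 0 mu Hst 0 y Hy).
unfold serv1_row, serv2_row in E0; cbv [prepend] in E0, E1.
set (R0 := row_gf (mode_array mu Operating) 0 y) in *.
set (S0 := row_gf (mode_array mu Setup) 0 y) in *.
set (R1 := row_gf (mode_array mu Operating) 1 y) in *.
set (c0 := RtoC (mode_array mu Operating 0 0)) in *.
set (c1 := RtoC (mode_array mu Operating 1 0)) in *.
assert (E : y * (lam0 a + gam a) * R0 - y * tau a * S0 - y * y * nu1 a * c1
            + (y - 1) * nu2 a * (R0 - c0) = 0).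
{ match type of E0 with ?l = ?r => transitivity (l - r); [ring | rewrite E0; ring] end. }
unfold G, D.
transitivity ((lam1 a + tau a) * (y * (lam0 a + gam a) * R0 - y * tau a * S0
                - y * y * nu1 a * c1 + (y - 1) * nu2 a * (R0 - c0))
  + y * tau a * ((lam1 a + tau a) * S0 - (0 + gam a * R0))
  + (lam1 a + tau a) * ((y - 1) * nu2 a * c0 + y * y * nu1 a * c1)); [ring|].
rewrite E, E1; ring.
Qed.

(** At [p = 0] the load of station 1 depends on [x] alone, so the equation at
    [y = Ytilde x] determines it and it can be eliminated. *)
Lemma expansion_at_p_0 (mu : state -> R) (x y : C) :
  is_stationary (rate a 0) mu -> (Cmod x <= 1)%R -> (Cmod y <= 1)%R ->
  G a x y <> 0 ->
  nu2 a * x * (Ytilde a x - 1) - nu1 a * Ytilde a x * (x - Ytilde a x) <> 0 ->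
  array_gf (mode_array mu Operating) x y
  = D a x * nu1 a * nu2 a * (Ytilde a x - y) * (Ytilde a x * (y - 1) + x - y)
     / (G a x y
        * (nu2 a * x * (Ytilde a x - 1) - nu1 a * Ytilde a x * (x - Ytilde a x)))
     * array_gf (mode_array mu Operating) 0 0.
Proof.
intros Hst Hx Hy NG NK.
set (f := mode_array mu Operating).
apply Cmult_reg_l with (1 := Cmult_neq_0 _ _ NG NK).
match goal with |- _ = ?k * (?n / ?k' * ?b) => transitivity (n * b) end;
  [|field; exact (conj NK NG)].
destruct (Ceq_dec x 0) as [->|Nx].
- assert (E := idle_row_equation mu y Hst Hy).
  assert (EY := idle_row_equation mu (Ytilde a 0) Hst
                  ltac:(apply Cmod_Ytilde_le_1; assumption)).
  rewrite G_Ytilde, Cmult_0_l in EY by assumption.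
  fold f in E, EY; set (Y := Ytilde a 0) in *.
  transitivity (nu1 a * Y * Y * (G a 0 y * array_gf f 0 y)); [ring|].
  rewrite E.
  transitivity (nu1 a * (D a 0 * nu2 a * (Y * Y * (y - 1) - y * y * (Y - 1))
                         * array_gf f 0 0)
    + nu1 a * y * y * (D a 0 * (nu2 a * (Y - 1) * array_gf f 0 0
                       + nu1 a * Y * Y * f 1%nat 0%nat))); [ring|].
  rewrite <- EY; ring.
- apply Cmult_reg_l with (1 := Nx).
  assert (E := functional_equation a 0 mu Hst x y Hx Hy); fold f in E.
  assert (EY := kernel_equation 0 mu x Hst Hx); fold f in EY.
  assert (L : forall z, load1 0 f x z = array_gf f x 0)
    by (intros z; unfold load1; ring).
  rewrite L in E, EY.
  set (K := nu2 a * x * (Ytilde a x - 1) - nu1 a * Ytilde a x * (x - Ytilde a x)) in *.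
  transitivity (K * (x * G a x y * array_gf f x y)); [ring|].
  rewrite E.
  transitivity (D a x * (nu2 a * x * (y - 1) - nu1 a * y * (x - y)) * (K * array_gf f x 0)
    + D a x * K * nu1 a * y * (x - y) * array_gf f 0 0); [ring|].
  rewrite EY; unfold K; ring.
Qed.

Hypothesis stability :
  (lam0 a * (1 / nu1 a + 1 / nu2 a) * (tau a / (tau a + gam a))
   + lam1 a * (1 / nu1 a + 1 / nu2 a) * (gam a / (tau a + gam a))
   < tau a / (tau a + gam a))%R.

(** Away from [x = 1] the kernel equation is solved for the load; at [x = 1] the
    kernel vanishes, but [Ytilde 1 = 1] and the load there is known. *)
Lemma load1_Ytilde_invariant (p q : R) (mu nu : state -> R) (x : C) :
  is_stationary (rate a p) mu -> is_stationary (rate a q) nu -> (Cmod x <= 1)%R ->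
  load1 p (mode_array mu Operating) x (Ytilde a x)
  = load1 q (mode_array nu Operating) x (Ytilde a x).
Proof.
intros Hm Hn Hx; destruct (Ceq_dec x 1) as [->|Nx].
- assert (Y1 : Ytilde a 1 = 1).
  { assert (H1 : arrival_exponent a 1 = 0) by (unfold arrival_exponent, Cdiv; ring).
    rewrite Ytilde_arrival_exponent, H1 by assumption; field.
    intros Z; apply RtoC_inj in Z; lra. }
  rewrite Y1; rewrite !(load1_at_1 a) by assumption; reflexivity.
- apply Cmult_reg_l with
    (nu2 a * x * (Ytilde a x - 1) - nu1 a * Ytilde a x * (x - Ytilde a x)).
  + intros Z; apply Nx, (kernel_zero a); assumption.
  + rewrite !kernel_equation by assumption.
    rewrite !(idle_probability a p), !(idle_probability a q) by assumption.
    reflexivity.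
Qed.

(** The loads at [y] and at [Ytilde x] differ by the mixed difference multiplied
    by the coupling parameter; the load at [Ytilde x] and the idle probability
    cancel between the two parameters. *)
Lemma coupling_identity (p : R) (mu mu0 : state -> R) (x y : C) :
  is_stationary (rate a p) mu -> is_stationary (rate a 0) mu0 ->
  (Cmod x <= 1)%R -> (Cmod y <= 1)%R -> x <> 0 ->
  let f := mode_array mu Operating in
  G a x y * (array_gf f x y - array_gf (mode_array mu0 Operating) x y)
  = p * (G10 a x y * (array_gf f x y - array_gf f x (Ytilde a x)
                      - array_gf f 0 y + array_gf f 0 (Ytilde a x))).
Proof.
intros Hm H0 Hx Hy Nx f; set (f0 := mode_array mu0 Operating).
assert (E := functional_equation a p mu Hm x y Hx Hy).
assert (E0 := functional_equation a 0 mu0 H0 x y Hx Hy).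
assert (I : array_gf f 0 0 = array_gf f0 0 0).
{ unfold f, f0; rewrite (idle_probability a p), (idle_probability a 0) by assumption.
  reflexivity. }
assert (L := load1_Ytilde_invariant p 0 mu mu0 x Hm H0 Hx).
fold f in E, L; fold f0 in E0, L; rewrite I in E.
assert (L0 : load1 0 f0 x y = load1 0 f0 x (Ytilde a x)) by (unfold load1; ring).
apply Cmult_reg_l with (1 := Nx).
transitivity (x * G a x y * array_gf f x y - x * G a x y * array_gf f0 x y); [ring|].
rewrite E, E0, L0, <- L; unfold load1, interior_gf, G10; field; exact Nx.
Qed.

End Perturbation.

Theorem theorem1
  (a : params)
  (lam0_pos : (0 < lam0 a)%R) (lam1_pos : (0 < lam1 a)%R)
  (nu1_pos : (0 < nu1 a)%R) (nu2_pos : (0 < nu2 a)%R)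
  (gam_pos : (0 < gam a)%R) (tau_pos : (0 < tau a)%R)
  (stability :
    (lam0 a * (1 / nu1 a + 1 / nu2 a) * (tau a / (tau a + gam a))
     + lam1 a * (1 / nu1 a + 1 / nu2 a) * (gam a / (tau a + gam a))
     < tau a / (tau a + gam a))%R)
  (pi : R -> state -> R)
  (pi_stationary : forall p : R, (0 <= p <= 1)%R -> is_stationary (rate a p) (pi p))
  (V : nat -> mode -> C -> C -> C)
  (V_expansion : forall (j : mode) (x y : C),
    (Cmod x <= 1)%R -> (Cmod y <= 1)%R ->
    expands_at_0 (fun p => gen_fun (pi p) j x y) (fun m => V m j x y))
  (x y : C) (hx : (Cmod x <= 1)%R) (hy : (Cmod y <= 1)%R) :
  ((G a x y <> 0 ->
   nu2 a * x * (Ytilde a x - 1) - nu1 a * Ytilde a x * (x - Ytilde a x) <> 0 ->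
   V 0%nat Operating x y
   = D a x * nu1 a * nu2 a * (Ytilde a x - y) * (Ytilde a x * (y - 1) + x - y)
     / (G a x y
        * (nu2 a * x * (Ytilde a x - 1) - nu1 a * Ytilde a x * (x - Ytilde a x)))
     * V 0%nat Operating 0 0)
  /\
  (forall m : nat, (0 < m)%nat -> x <> 0 -> G a x y <> 0 ->
   V m Operating x y = G10 a x y / G a x y * Q a V (m - 1) x y)
  /\
  (forall m : nat, V m Setup x y = gam a / D a x * V m Operating x y))%C.
Proof.
assert (St0 : is_stationary (rate a 0) (pi 0%R)) by (apply pi_stationary; lra).
assert (hY : (Cmod (Ytilde a x) <= 1)%R) by (apply Cmod_Ytilde_le_1; assumption).
assert (h0 := Cmod_0_le_1).
split; [|split].
- intros NG NK.
  rewrite (expands_at_0_coef_0 _ _ (V_expansion Operating x y hx hy)),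
    (expands_at_0_coef_0 _ _ (V_expansion Operating 0 0 h0 h0)).
  apply (expansion_at_p_0 a); assumption.
- intros [|m] Hm Nx NG; [lia|].
  replace (S m - 1)%nat with m by lia.
  assert (E := expands_at_0_plus _ _ _ _
    (expands_at_0_scal (G a x y) _ _
      (expands_at_0_plus _ _ _ _ (V_expansion Operating x y hx hy)
        (expands_at_0_const (- gen_fun (pi 0%R) Operating x y))))
    (expands_at_0_incr _ _ (expands_at_0_scal (- G10 a x y) _ _
      (expands_at_0_plus _ _ _ _
        (expands_at_0_plus _ _ _ _ (V_expansion Operating x y hx hy)
          (expands_at_0_scal (- RtoC 1) _ _ (V_expansion Operating x _ hx hY)))
        (expands_at_0_plus _ _ _ _
          (expands_at_0_scal (- RtoC 1) _ _ (V_expansion Operating 0 y h0 hy))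
          (V_expansion Operating 0 _ h0 hY)))))).
  apply expands_at_0_zero with (m := S m) in E.
  + apply Cmult_reg_l with (1 := NG).
    match type of E with ?l = _ =>
      transitivity (l + G10 a x y * Q a V m x y); [unfold Q; ring|] end.
    rewrite E; field; exact NG.
  + intros p Hp.
    assert (C := coupling_identity a lam0_pos lam1_pos nu1_pos nu2_pos gam_pos tau_pos
      stability p (pi p) (pi 0%R) x y (pi_stationary p Hp) St0 hx hy Nx).
    cbv zeta in C; change (array_gf (mode_array (pi p) Operating))
      with (gen_fun (pi p) Operating) in C.
    change (array_gf (mode_array (pi 0%R) Operating))
      with (gen_fun (pi 0%R) Operating) in C.
    match type of C with ?l = ?r => transitivity (l - r); [ring | rewrite C; ring] end.
- intros m.
  assert (ND : D a x <> 0) by (apply D_neq_0; assumption).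
  assert (E := expands_at_0_plus _ _ _ _
    (expands_at_0_scal (D a x) _ _ (V_expansion Setup x y hx hy))
    (expands_at_0_scal (- gam a) _ _ (V_expansion Operating x y hx hy))).
  apply expands_at_0_zero with (m := m) in E.
  + apply Cmult_reg_l with (1 := ND).
    match type of E with ?l = _ =>
      transitivity (l + gam a * V m Operating x y); [ring|] end.
    rewrite E; field; exact ND.
  + intros p Hp.
    assert (C := gf_balance_Setup a p (pi p) (pi_stationary p Hp) x y hx hy).
    change (D a x * gen_fun (pi p) Setup x y
            = gam a * gen_fun (pi p) Operating x y) in C.
    rewrite C; ring.
Qed.
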